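(* Let $V$ be a finite-dimensional complex vector space, $N\ge1$, $R\in\mathrm{Mer}(V^{\otimes2})^\times$ such that $R^{t_1}\in\mathrm{Mer}(V^{\otimes2})^\times$, $K^+,K^-\in\mathrm{Mer}(V)^\times$, $M\in\mathrm{GL}(V)$, $r\in\mathbb C^\times$ and $\boldsymbol z=(z_1,\dots,z_N)\in(\mathbb C^\times)^N$. Assume the following conditions (for generic $x,y$ where these occur): (a) Yang–Baxter equation: $R_{12}(x/y)R_{13}(x)R_{23}(y)=R_{23}(y)R_{13}(x)R_{12}(x/y)$ in $\mathrm{End}(V^{\otimes3})$; (b) left and right reflection equations in $\mathrm{End}(V^{\otimes2})$: $$R_{12}(x/y)K^+_1(x)R_{21}(xy)K^+_2(y)=K^+_2(y)R_{12}(xy)K^+_1(x)R_{21}(x/y),$$ $$R_{21}(x/y)K^-_1(x)R_{12}(xy)K^-_2(y)=K^-_2(y)R_{21}(xy)K^-_1(x)R_{12}(x/y);$$ (c) crossing symmetry: $M_2^{-1}R_{12}(r^2x)^{-1}M_2\propto\tilde R_{12}(x)$, and $[R(x),M\otimes M]=0$; (d) boundary regularity: $K^+(\pm1)\propto\mathrm{Id}_V$ and $K^-(\pm1)\propto\mathrm{Id}_V$; (e) regularity: $R(1)\propto P$; (f) there is $J\in\mathrm{GL}(V)$ with $R_{12}(x)J_1J_2=J_1J_2R_{21}(x)$; (g) boundary unitarity: $K^\pm(x)K^\pm(x^{-1})\propto\mathrm{Id}_V$; (h) $\pm r^{-1}\in\mathrm{dom}(K^-)$. Write $K'=\phi_{\tilde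 R}(K^+)$ and assume $\pm1\in\mathrm{dom}(K')$ and $K'(\pm r^{-1})\propto M$. Assume that $R$, $K'$ and $K^-$ are polynomial in $x$ of degree $1$, $2$ and $2$, respectively, and that with respect to a certain ordered basis $(v_\alpha)_{\alpha=1}^n$ of $V$ we have, for all $\alpha,\beta\in\{1,\dots,n\}$ and all $x$, writing $\bar\alpha=n+1-\alpha$, $$R(x)(v_\alpha\otimes v_\beta)\in\mathbb C\,v_\alpha\otimes v_\beta+\mathbb C\,v_\beta\otimes v_\alpha,\qquad R(0)(v_\alpha\otimes v_\beta)\in\sum_{\gamma\le\alpha,\ \delta\ge\beta}\mathbb C\,v_\gamma\otimes v_\delta,$$ $$K^-(x)(v_\alpha),\ K'(x)(v_\alpha)\in\mathbb C v_\alpha+\mathbb C v_{\bar\alpha},\qquad K^-(0)(v_\alpha)\in\sum_{\gamma\le\alpha}\mathbb C v_{\bar\gamma},\qquad K'(0)(v_{\bar\alpha})\in\sum_{\gamma\le\alpha}\mathbb C v_\gamma.$$ Let $$\mathcal T(x;\boldsymbol z)=\mathrm{Tr}_0\,K'_0(x)\,R_{01}(\tfrac1{xz_1})^{-1}\cdots R_{0N}(\tfrac1{xz_N})^{-1}K^-_0(x)\,R_{0N}(\tfrac{x}{z_N})\cdots R_{01}(\tfrac{x}{z_1})\in\mathrm{End}(V^{\otimes N}).$$ Then $[\mathcal T(x;\boldsymbol z),\mathcal T(y;\boldsymbol z)]=0$ for all $x,y\in\mathrm{dom}(\mathcal T)$.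
   Context: $\mathrm{Mer}(V)$ is the algebra of meromorphic functions $\mathbb C\to\mathrm{End}(V)$, and $\mathrm{Mer}(V)^\times$ the subset of those whose values are invertible for generic argument. $\mathrm{dom}(F)$ is the set of points at which a meromorphic function $F$ is defined (has no pole); for $\mathcal T$ this refers to $x\mapsto\mathcal T(x;\boldsymbol z)$. ''For generic values'' means outside a proper analytic subset. $X\propto Y$ means $X=mY$ with $m\in\mathbb C^\times$; for meromorphic functions, $X(x)\propto Y(x)$ for generic $x$ means $X(x)=m(x)Y(x)$ with $m$ a not identically zero scalar meromorphic function. Tensor-leg notation: the subscripts of an operator indicate in which tensor factors (and in which order) it acts, with identity action in the others; the factor labelled $0$ is an auxiliary copy of $V$ and $1,\dots,N$ label the factors of $V^{\otimes N}$. $P(v\otimes v')=v'\otimes v$ and $R_{21}=PRP$. $X^{t_i}$, $\mathrm{Tr}_iX$ are the partial transpose and partial trace in the factor labelled $i$ (transposition in a fixed basis of $V$). $\tilde R(x):=((R(x)^{t_1})^{-1})^{t_1}$. For $Q\in\mathrm{Mer}(V^{\otimes2})$ the map $\phi_Q:\mathrm{Mer}(V)\to\mathrm{Mer}(V)$ is $\phi_Q(Y)_1(x)=\mathrm{Tr}_0\,Y_0(x)P_{01}Q_{01}(x^2)$; $\phi_{\tilde R}$ is this map with $Q=\tilde R$. *)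

(* Defs.v *)
From HB Require Import structures.
From mathcomp Require Import all_boot all_order all_algebra.
From mathcomp Require Import complex mxtens.
From mathcomp Require Import boolp classical_sets reals topology normedtype derive.

Set Implicit Arguments.
Unset Strict Implicit.
Unset Printing Implicit Defensive.

Import Order.TTheory GRing.Theory Num.Theory.
Import numFieldNormedType.Exports.

Local Open Scope classical_set_scope.
Local Open Scope ring_scope.

(* The analytic notions below are used with K the field of complex numbers,
   where [derivable G z 1] is complex differentiability. *)

Section Meromorphic.
Variables (K : numFieldType) (W : normedModType K).
Implicit Types (F G : K -> W) (x : K).

Definition holomorphic_at G x := \forall z \near x, derivable G z 1.

(* F has at most a pole of order k at x; the value of F at x is irrelevant. *)
Definition pole_le (k : nat) F x :=
  exists2 G, holomorphic_at G x & \forall z \near x^', F z = (z - x) ^- k *: G z.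

Definition meromorphic_on (D : set K) F :=
  forall x, D x -> exists k, pole_le k F x.

Definition dom F : set K := [set x | pole_le 0 F x].

(* A formula such as [x |-> Tr (A x *m invmx (B x))] is evaluated pointwise and
   may take wrong values at isolated points; [reg F] has the same germs on
   punctured neighbourhoods, and the right value at every point of [dom F]. *)
Definition reg F : K -> W := fun x => lim (F @ x^').

(* Meromorphic functions on K, represented by total functions whose values are
   the right ones on [dom F] and unspecified at the poles. *)
Definition Mer F :=
  meromorphic_on setT F /\ forall x, dom F x -> F x = reg F x.

End Meromorphic.

Section Generic.
Variables (K : numFieldType) (V : normedModType K).

(* For an open subset D of V. *)
Definition analytic_subset (D A : set V) :=
  A `<=` D /\
  forall p, D p -> exists (k : nat) (f : 'I_k -> V -> K),
    (forall i, \forall q \near p, differentiable (f i) q) /\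
    (\forall q \near p, A q <-> forall i, f i q = 0).

(* P holds on D outside a proper analytic subset of D. *)
Definition generic (D : set V) (P : V -> Prop) :=
  exists A, [/\ analytic_subset D A, A <> D & forall q, D q -> ~ A q -> P q].

End Generic.

Section Operators.
Variable K : numFieldType.

Definition generic1 (D : set K) (P : K -> Prop) := generic D P.
Definition generic2 (D : set (K * K)) (P : K -> K -> Prop) :=
  generic D (fun p => P p.1 p.2).

Definition nz : set K := [set x | x != 0].
Definition nz2 : set (K * K) := [set p | p.1 != 0 /\ p.2 != 0].

Definition propto m n (X Y : 'M[K]_(m, n)) := exists2 c : K, c != 0 & X = c *: Y.

Definition mer_propto m n (D : set K) (X Y : K -> 'M[K]_(m, n)) :=
  exists c : K -> K,
    [/\ meromorphic_on D c,
        exists x, [/\ D x, dom c x & reg c x != 0]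
      & generic1 D (fun x => X x = c x *: Y x)].

Definition MerU m (F : K -> 'M[K]_m) :=
  Mer F /\ generic1 setT (fun x => F x \in unitmx).

Definition polynomial_of_degree m n (d : nat) (F : K -> 'M[K]_(m, n)) :=
  exists A : 'I_d.+1 -> 'M[K]_(m, n),
    A ord_max != 0 /\ forall x, F x = \sum_(i < d.+1) x ^+ i *: A i.

Variable n : nat.

(* V = K^n, with transposition in the standard basis; End(V (x) V) is
   'M_(n * n), indexed by pairs via mxtens_index, as in the Kronecker
   product *t of mxtens. *)
Implicit Type X : 'M[K]_(n * n).

Definition flip : 'M[K]_(n * n) := \sum_i \sum_j delta_mx i j *t delta_mx j i.

Definition op21 X := flip *m X *m flip.

Definition leg_1 (Y : 'M[K]_n) : 'M[K]_(n * n) := Y *t 1%:M.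
Definition leg_2 (Y : 'M[K]_n) : 'M[K]_(n * n) := 1%:M *t Y.

Definition ptrans1 X : 'M[K]_(n * n) :=
  \matrix_(s, t)
    let: (i, j) := mxtens_unindex s in let: (k, l) := mxtens_unindex t in
    X (mxtens_index (k, j)) (mxtens_index (i, l)).

Definition ptrace1 X : 'M[K]_n :=
  \matrix_(i, j) \sum_a X (mxtens_index (a, i)) (mxtens_index (a, j)).

Definition Rtilde (R : K -> 'M[K]_(n * n)) : K -> 'M[K]_(n * n) :=
  fun x => ptrans1 (invmx (ptrans1 (R x))).

Definition phi (Q : K -> 'M[K]_(n * n)) (Y : K -> 'M[K]_n) : K -> 'M[K]_n :=
  reg (fun x => ptrace1 (leg_1 (Y x) *m flip *m Q (x ^+ 2))).

(* End(V^{(x) k}): square matrices whose rows and columns are indexed, through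
   the enumeration of the finite type, by {ffun 'I_k -> 'I_n}. *)
Definition tdim (k : nat) := #|{ffun 'I_k -> 'I_n}|.

Definition multi_index k (a : 'I_(tdim k)) : {ffun 'I_k -> 'I_n} := enum_val a.

(* Y acting in the tensor factor i. *)
Definition leg1 k (i : 'I_k) (Y : 'M[K]_n) : 'M[K]_(tdim k) :=
  \matrix_(a, b)
    let s := multi_index a in let t := multi_index b in
    Y (s i) (t i) *+ [forall l, (l != i) ==> (s l == t l)].

(* X acting in the tensor factors i and j, in this order (i != j). *)
Definition leg2 k (i j : 'I_k) X : 'M[K]_(tdim k) :=
  \matrix_(a, b)
    let s := multi_index a in let t := multi_index b in
    X (mxtens_index (s i, s j)) (mxtens_index (t i, t j))
      *+ [forall l, (l != i) && (l != j) ==> (s l == t l)].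

Definition fcons k (a : 'I_n) (s : {ffun 'I_k -> 'I_n}) :
    {ffun 'I_k.+1 -> 'I_n} :=
  [ffun l => oapp s a (unlift ord0 l)].

(* Partial trace in the factor 0 of V^{(x) (k + 1)}. *)
Definition ptrace0 k (Z : 'M[K]_(tdim k.+1)) : 'M[K]_(tdim k) :=
  \matrix_(a, b) \sum_c
    Z (enum_rank (fcons c (multi_index a))) (enum_rank (fcons c (multi_index b))).

Definition yang_baxter (R : K -> 'M[K]_(n * n)) (x y : K) :=
  let R_ (i j : nat) u := leg2 (inord i.-1 : 'I_3) (inord j.-1) (R u) in
  R_ 1%N 2 (x / y) *m R_ 1%N 3 x *m R_ 2%N 3 y =
  R_ 2%N 3 y *m R_ 1%N 3 x *m R_ 1%N 2 (x / y).

(* With R' := R_21 this is the left reflection equation; the right one is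
   obtained by exchanging R and R'. *)
Definition reflection_eq (R R' : K -> 'M[K]_(n * n)) (Y : K -> 'M[K]_n)
    (x y : K) :=
  R (x / y) *m leg_1 (Y x) *m R' (x * y) *m leg_2 (Y y) =
  leg_2 (Y y) *m R (x * y) *m leg_1 (Y x) *m R' (x / y).

(* The second product runs from the factor N down to the factor 1. *)
Definition transfer N (K' : K -> 'M[K]_n) (R : K -> 'M[K]_(n * n))
    (Km : K -> 'M[K]_n) (z : 'I_N -> K) : K -> 'M[K]_(tdim N) :=
  let R0 (i : 'I_N) u := leg2 ord0 (lift ord0 i) (R u) in
  reg (fun x => ptrace0
    (leg1 ord0 (K' x)
     *m (\prod_(i < N) invmx (R0 i (x * z i)^-1))
     *m leg1 ord0 (Km x)
     *m (\prod_(i < N) R0 (rev_ord i) (x / z (rev_ord i))))).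

End Operators.

Arguments flip {K n}.
Arguments nz {K}.
Arguments nz2 {K}.

(* Main.v *)
Require Import Defs.
From HB Require Import structures.
From mathcomp Require Import all_boot all_order all_algebra.
From mathcomp Require Import complex mxtens.
From mathcomp Require Import boolp classical_sets reals topology normedtype derive.
From mathcomp Require Import functions filter ring.

Set Implicit Arguments.
Unset Strict Implicit.
Unset Printing Implicit Defensive.

Import Order.TTheory GRing.Theory Num.Theory.
Import numFieldNormedType.Exports.

Local Open Scope classical_set_scope.
Local Open Scope ring_scope.

(* Sklyanin's argument. Since R, K' and K^- are polynomial, a generic identity
   only has to hold on some nonempty open set to hold everywhere; this applies
   to the Yang-Baxter equation and to the reflection equation of K^-. The map
   phi_R~ is inverted by phi_R, so K^+ coincides with a polynomial off a
   discrete set and its reflection equation, too, extends to all arguments.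

   The reflection equation of K^+ = phi_R(K') yields the dual one for K',
     R(x/y) K'_2(y) R~(xy) K'_1(x) = K'_1(x) R~_21(xy) K'_2(y) R_21(x/y),
   and dressing K^-_0(x) by the factors R_0i yields another solution of the
   right reflection equation, by the Yang-Baxter equation. As
   Tr_0 (R~_01 X R_01) = Tr_0 X whenever X does not act on the factor 1, the
   product T(x) T(y) is a single trace over two auxiliary factors, in which
   R(x/y) and the two reflection equations exchange x and y. This holds for all
   (x, y) avoiding finitely many exceptional values of each variable, and the
   remaining cases follow by passing to the limit. *)

(** * Operators on tensor legs *)

(** Several instances of the Yang-Baxter equation and both reflection equations must hold at once,
    at linked arguments such as [(x^2, xy)] or [(x/z_i, 1/(y z_i))]. Intersecting generic sets and
    pulling them back along such maps would require that proper analytic subsets have empty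
    interior. Extending each identity beforehand avoids this: one open set is all that genericity
    has to supply. The obstacle to the extension is [R(x/y)], which is not polynomial in [y]; as [R]
    has degree 1, [y R(x/y)] is, and the equations are linear in [R(x/y)]. The behaviour of [R~]
    comes from a twisted product, [(a (x) b)(c (x) d) = ca (x) bd]. Since [phi_Q(Y) = aYb] for
    [Q = a (x) b], composing maps [phi] multiplies their [Q] in this product, where [R~] is the
    inverse of [R]. The same product describes [Tr_i (X_ij Z X'_ij)]. Traces keep the traced factor
    as a leg on which the result is the identity. Thus all operators of a computation lie in one
    matrix ring, and not acting on a leg means commuting with every [leg1] there. *)

Section Legs.
Variables (K : numFieldType) (n : nat).

Lemma mul_mxE m (A B : 'M[K]_m) a b : (A * B) a b = \sum_u A a u * B u b.
Proof. by rewrite -mulmxE mxE. Qed.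

Lemma mul_mxZl m c (A B : 'M[K]_m) : (c *: A) * B = c *: (A * B).
Proof. by rewrite -!mulmxE scalemxAl. Qed.

Lemma mul_mxZr m c (A B : 'M[K]_m) : A * (c *: B) = c *: (A * B).
Proof. by rewrite -!mulmxE scalemxAr. Qed.

(** Entries of a local operator vanish unless the indices are [e]-related, that is, equal outside
    the active legs; [pi] reads these legs and [m s w] overwrites them by [w]. A nonzero term forces
    [u = m a w], so the sum collapses to one over the active legs. *)
Lemma sum_local (S A : finType) (pi : S -> A) (e : rel S) (m : S -> A -> S)
    (X Y : A -> A -> K) :
    symmetric e -> transitive e ->
    (forall s w, pi (m s w) = w) -> (forall s w, e s (m s w)) ->
    (forall s u, e s u -> m s (pi u) = u) ->
  forall a b, \sum_u (X (pi a) (pi u) *+ e a u) * (Y (pi u) (pi b) *+ e u b) =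
    (\sum_w X (pi a) w * Y w (pi b)) *+ e a b.
Proof.
move=> esym etrans pim em mpi a b.
rewrite (bigID (e a)) /= [X in _ + X]big1 ?addr0; last first.
  by move=> u /negbTE->; rewrite mul0r.
rewrite (reindex_onto (m a) pi) => [|u /mpi //].
rewrite -sumrMnl; apply: eq_big => [w|w _]; first by rewrite em pim eqxx.
rewrite pim em mulr1n mulrnAr; congr (_ *+ nat_of_bool _).
have eam := em a w.
apply/idP/idP => [|eab]; first exact: etrans.
by apply: etrans eab; rewrite esym.
Qed.

Section Index.
Variable k : nat.
Implicit Types (P : pred 'I_k) (i j : 'I_k) (s t : {ffun 'I_k -> 'I_n}).

Lemma sum_multi (F : {ffun 'I_k -> 'I_n} -> K) :
  \sum_(u < tdim n k) F (multi_index u) = \sum_s F s.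
Proof.
rewrite (reindex_onto enum_rank enum_val) => [|u _]; last exact: enum_valK.
by apply: eq_big => s; rewrite /multi_index enum_rankK ?eqxx.
Qed.

Definition upd s i q : {ffun 'I_k -> 'I_n} :=
  [ffun l => if l == i then q else s l].

Lemma updE s i q l : upd s i q l = if l == i then q else s l.
Proof. by rewrite ffunE. Qed.

Definition agree (P : pred 'I_k) : rel {ffun 'I_k -> 'I_n} :=
  fun s t => [forall l, P l ==> (s l == t l)].

Lemma agreeP P s t : reflect (forall l, P l -> s l = t l) (agree P s t).
Proof.
apply: (iffP forallP) => [H l Pl|H l]; last by apply/implyP => /H->.
by apply/eqP; move/implyP: (H l); apply.
Qed.

Lemma agree_sym P : symmetric (agree P).
Proof.
by move=> s t; apply/agreeP/agreeP => H l /H.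
Qed.

Lemma agree_trans P : transitive (agree P).
Proof.
by move=> t s u /agreeP H /agreeP H'; apply/agreeP => l Pl; rewrite H ?H'.
Qed.

Lemma leg1E i (Y : 'M[K]_n) a b :
  leg1 i Y a b = Y (multi_index a i) (multi_index b i)
    *+ agree (fun l => l != i) (multi_index a) (multi_index b).
Proof. by rewrite mxE. Qed.

Lemma leg2E i j (X : 'M[K]_(n * n)) a b :
  leg2 i j X a b =
  X (mxtens_index (multi_index a i, multi_index a j))
    (mxtens_index (multi_index b i, multi_index b j))
    *+ agree (fun l => (l != i) && (l != j)) (multi_index a) (multi_index b).
Proof. by rewrite mxE. Qed.

Lemma leg1M i (A B : 'M[K]_n) : leg1 i (A *m B) = leg1 i A * leg1 i B.
Proof.
apply/matrixP => a b; rewrite mul_mxE.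
under eq_bigr do rewrite !leg1E.
rewrite (sum_multi (fun u => (A (multi_index a i) (u i)
   *+ agree (fun l => l != i) (multi_index a) u) * (B (u i) (multi_index b i)
   *+ agree (fun l => l != i) u (multi_index b)))).
rewrite (@sum_local _ _ (fun s : {ffun 'I_k -> 'I_n} => s i)
  (agree (fun l => l != i)) (fun s => upd s i) A B) ?leg1E ?mxE //.
- exact: agree_sym.
- exact: agree_trans.
- by move=> s w; rewrite updE eqxx.
- by move=> s w; apply/agreeP => l /negbTE li; rewrite updE li.
- move=> s u /agreeP su; apply/ffunP => l; rewrite updE.
  by case: eqP => [->//|/eqP/su].
Qed.

Lemma leg1_scalar i c : leg1 i (c%:M : 'M[K]_n) = c%:M.
Proof.
apply/matrixP => a b; rewrite leg1E !mxE -mulrnA mulnb; congr (_ *+ nat_of_bool _).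
apply/andP/eqP => [[/eqP ab /agreeP H]|->]; last first.
  by split => //; apply/agreeP.
apply: enum_val_inj; apply/ffunP => l.
by case: (eqVneq l i) => [->|/H].
Qed.

Lemma leg1_1 i : leg1 i (1%:M : 'M[K]_n) = 1.
Proof. exact: leg1_scalar. Qed.

Lemma leg1_is_linear i : linear (@leg1 K n k i).
Proof.
move=> c A B; apply/matrixP => a b.
by rewrite leg1E [RHS]mxE [in RHS]mxE !leg1E !mxE mulrnDl mulrnAr.
Qed.

HB.instance Definition _ i :=
  GRing.isLinear.Build K 'M[K]_n 'M[K]_(tdim n k) _ (@leg1 K n k i)
    (leg1_is_linear i).

Lemma leg2_is_linear i j : linear (@leg2 K n k i j).
Proof.
move=> c A B; apply/matrixP => a b.
by rewrite leg2E [RHS]mxE [in RHS]mxE !leg2E !mxE mulrnDl mulrnAr.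
Qed.

HB.instance Definition _ i j :=
  GRing.isLinear.Build K 'M[K]_(n * n) 'M[K]_(tdim n k) _ (@leg2 K n k i j)
    (leg2_is_linear i j).

Lemma leg2_tens i j (A B : 'M[K]_n) :
  i != j -> leg2 i j (A *t B) = leg1 i A * leg1 j B.
Proof.
move=> ij; apply/matrixP => a b; rewrite mul_mxE leg2E.
under eq_bigr do rewrite !leg1E.
set s := multi_index a; set t := multi_index b.
rewrite (sum_multi (fun u => (A (s i) (u i)
   *+ agree (fun l => l != i) s u) * (B (u j) (t j)
   *+ agree (fun l => l != j) u t))).
(* [A] changes only the leg [i] and [B] only the leg [j], so the intermediate index is [s] with its
   entry at [i] already replaced. *)
rewrite (bigD1 (upd s i (t i))) //= big1 ?addr0; last first.
  move=> u ut.
  case: (boolP (agree (fun l => l != i) s u)) => [/agreeP su|_]; last by rewrite mul0r.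
  case: (boolP (agree (fun l => l != j) u t)) => [/agreeP ut'|_]; last by rewrite mulr0.
  case/eqP: ut; apply/ffunP => l; rewrite updE.
  by case: eqP => [->|/eqP/su//]; rewrite ut'.
rewrite tensmxE !updE eqxx eq_sym (negbTE ij) mulrnAr mulrnAl -mulrnA mulnb.
congr (_ *+ nat_of_bool _); apply/agreeP/andP => [H|[/agreeP H1 /agreeP H2] l].
  split; apply/agreeP => l; rewrite updE; first by move/negbTE=>->.
  by move=> lj; case: eqP => [->//|/eqP li]; apply: H; apply/andP.
by move=> /andP[li lj]; rewrite H1 // H2.
Qed.

(** Kronecker products of matrix units span, so an identity linear in [X] has only to be verified on
    [A *t B], where the legs separate. Most two-leg identities below are obtained in this way. *)
Lemma tens_span (P : 'M[K]_(n * n) -> Prop) :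
  (forall A B, P (A *t B)) -> (forall X Y, P X -> P Y -> P (X + Y)) ->
  (forall c X, P X -> P (c *: X)) -> forall X, P X.
Proof.
move=> Pt PD PZ X.
have ->: X = \sum_p \sum_q \sum_r \sum_s
    X (mxtens_index (p, q)) (mxtens_index (r, s)) *:
      (delta_mx p r *t delta_mx q s).
  apply/matrixP => a b.
  case: (mxtens_indexP a) => p q; case: (mxtens_indexP b) => r s.
  rewrite summxE (bigD1 p) //= summxE (bigD1 q) //= summxE (bigD1 r) //=.
  rewrite summxE (bigD1 s) //= !mxE !mxtens_indexK /= !eqxx /= !mulr1.
  rewrite !big1 ?addr0 //.
  - move=> i /negbTE ip; rewrite summxE big1 // => j _; rewrite summxE big1 // => l _.
    rewrite summxE big1 // => m _.
    by rewrite !mxE !mxtens_indexK /= [p == i]eq_sym ip !(mul0r, mulr0).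
  - move=> i /negbTE ip; rewrite summxE big1 // => j _; rewrite summxE big1 // => l _.
    by rewrite !mxE !mxtens_indexK /= [q == i]eq_sym ip !(mul0r, mulr0).
  - move=> i /negbTE ip; rewrite summxE big1 // => j _.
    by rewrite !mxE !mxtens_indexK /= [r == i]eq_sym ip andbF !(mul0r, mulr0).
  - move=> i /negbTE ip.
    by rewrite !mxE !mxtens_indexK /= [s == i]eq_sym ip andbF !(mul0r, mulr0).
have P0 : P 0 by rewrite -(scale0r 0); apply: PZ; rewrite -(tens0mx (0 : 'M_n)).
by do 4!(apply: (big_ind P) => // ? _); apply: PZ.
Qed.

Lemma tens_bilin_span (P : 'M[K]_(n * n) -> 'M[K]_(n * n) -> Prop) :
  (forall A B C D, P (A *t B) (C *t D)) ->
  (forall X Y Z, P X Z -> P Y Z -> P (X + Y) Z) ->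
  (forall c X Z, P X Z -> P (c *: X) Z) ->
  (forall X Y Z, P Z X -> P Z Y -> P Z (X + Y)) ->
  (forall c X Z, P Z X -> P Z (c *: X)) -> forall X Y, P X Y.
Proof.
move=> Pt PD PZ PD' PZ' X Y; move: X; apply: tens_span => [A B|? ?|? ?]; first last.
- exact: PZ.
- exact: PD.
by move: Y; apply: tens_span => [C D|? ?|? ?]; [exact: Pt|exact: PD'|exact: PZ'].
Qed.

Lemma leg1C i j (A B : 'M[K]_n) :
  i != j -> leg1 i A * leg1 j B = leg1 j B * leg1 i A.
Proof.
move=> ij; rewrite -leg2_tens // -leg2_tens 1?eq_sym //.
apply/matrixP => a b; rewrite !leg2E !tensmxE mulrC; congr (_ *+ nat_of_bool _).
by apply/agreeP/agreeP => H l /andP[? ?]; apply: H; apply/andP.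
Qed.

Lemma leg2M i j (X Y : 'M[K]_(n * n)) :
  i != j -> leg2 i j (X *m Y) = leg2 i j X * leg2 i j Y.
Proof.
move=> ij; move: X Y; apply: tens_bilin_span => [A B C D|X Y Z|c X Z|X Y Z|c X Z].
- rewrite tensmx_mul !leg2_tens // !leg1M -!mulrA; congr (_ * _).
  by rewrite !mulrA; congr (_ * _); rewrite leg1C.
- by rewrite mulmxDl !linearD /= mulrDl => -> ->.
- by rewrite -scalemxAl !linearZ /= mul_mxZl => ->.
- by rewrite mulmxDr !linearD /= mulrDr => -> ->.
- by rewrite -scalemxAr !linearZ /= mul_mxZr => ->.
Qed.

Lemma leg2_leg_1 i j (A : 'M[K]_n) : i != j -> leg2 i j (leg_1 A) = leg1 i A.
Proof. by move=> ij; rewrite leg2_tens // leg1_1 mulr1. Qed.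

Lemma leg2_leg_2 i j (A : 'M[K]_n) : i != j -> leg2 i j (leg_2 A) = leg1 j A.
Proof. by move=> ij; rewrite leg2_tens // leg1_1 mul1r. Qed.

Lemma tens11 : (1%:M : 'M[K]_n) *t (1%:M : 'M_n) = 1%:M.
Proof.
apply/matrixP => a b; case: (mxtens_indexP a) => p q.
case: (mxtens_indexP b) => r s; rewrite tensmxE !mxE -natrM mulnb.
by rewrite (can_eq (@mxtens_indexK _ _)) xpair_eqE.
Qed.

Lemma leg2_1 i j : i != j -> leg2 i j (1%:M : 'M[K]_(n * n)) = 1.
Proof. by move=> ij; rewrite -tens11 leg2_tens // !leg1_1 mulr1. Qed.

End Index.
End Legs.

(** * Embeddings and partial traces *)

Section Embedding.
Variables (K : numFieldType) (n : nat).

Lemma multi_rank k (s : {ffun 'I_k -> 'I_n}) : multi_index (enum_rank s) = s.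
Proof. exact: enum_rankK. Qed.

Lemma rank_multi k (a : 'I_(tdim n k)) : enum_rank (multi_index a) = a.
Proof. exact: enum_valK. Qed.

Section Emb.
Variables (k m : nat) (f : 'I_k -> 'I_m).

Definition pull (s : {ffun 'I_m -> 'I_n}) : {ffun 'I_k -> 'I_n} :=
  [ffun l => s (f l)].

Definition push (s : {ffun 'I_m -> 'I_n}) (w : {ffun 'I_k -> 'I_n}) :
    {ffun 'I_m -> 'I_n} :=
  [ffun l => if [pick l' | f l' == l] is Some l' then w l' else s l].

(** Change of the number of legs: an identity on three legs (Yang-Baxter) or on the [N] quantum legs
    is compared with one on a space that also contains auxiliary legs. *)
Definition emb (Z : 'M[K]_(tdim n k)) : 'M[K]_(tdim n m) :=
  \matrix_(a, b)
    (Z (enum_rank (pull (multi_index a))) (enum_rank (pull (multi_index b)))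
     *+ agree (fun l => l \notin codom f) (multi_index a) (multi_index b)).

Lemma embE Z a b : emb Z a b =
  Z (enum_rank (pull (multi_index a))) (enum_rank (pull (multi_index b)))
     *+ agree (fun l => l \notin codom f) (multi_index a) (multi_index b).
Proof. by rewrite mxE. Qed.

Lemma emb_is_linear : linear emb.
Proof.
move=> c A B; apply/matrixP => a b.
by rewrite embE [RHS]mxE [in RHS]mxE !embE !mxE mulrnDl mulrnAr.
Qed.

HB.instance Definition _ :=
  GRing.isLinear.Build K 'M[K]_(tdim n k) 'M[K]_(tdim n m) _ emb emb_is_linear.

Hypothesis f_inj : injective f.

Lemma pull_push s w : pull (push s w) = w.
Proof.
apply/ffunP => l; rewrite !ffunE; case: pickP => [l' /eqP/f_inj->//|/(_ l)].
by rewrite eqxx.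
Qed.

Lemma push_agree s w : agree (fun l => l \notin codom f) s (push s w).
Proof.
apply/agreeP => l lf; rewrite ffunE; case: pickP => // l' /eqP fl.
by rewrite -fl codom_f in lf.
Qed.

Lemma push_pull s u :
  agree (fun l => l \notin codom f) s u -> push s (pull u) = u.
Proof.
move=> /agreeP H; apply/ffunP => l; rewrite !ffunE.
case: pickP => [l' /eqP<-|nf]; first by rewrite ffunE.
by apply: H; apply/codomP => -[l' El]; move: (nf l'); rewrite El eqxx.
Qed.

Lemma embM A B : emb (A * B) = emb A * emb B.
Proof.
apply/matrixP => a b; rewrite mul_mxE.
under eq_bigr do rewrite !embE.
pose ag := @agree n m (fun l => l \notin codom f).
rewrite (sum_multi (fun u =>
  (A (enum_rank (pull (multi_index a))) (enum_rank (pull u))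
   *+ ag (multi_index a) u) *
  (B (enum_rank (pull u)) (enum_rank (pull (multi_index b)))
   *+ ag u (multi_index b)))).
rewrite (@sum_local _ _ _ pull ag push (fun s t => A (enum_rank s) (enum_rank t))
  (fun s t => B (enum_rank s) (enum_rank t))).
- rewrite embE mul_mxE; congr (_ *+ _).
  rewrite -(sum_multi (fun w => A (enum_rank (pull (multi_index a))) (enum_rank w)
    * B (enum_rank w) (enum_rank (pull (multi_index b))))).
  by apply: eq_bigr => u _; rewrite rank_multi.
- exact: agree_sym.
- exact: agree_trans.
- exact: pull_push.
- exact: push_agree.
- exact: push_pull.
Qed.

Lemma emb_leg1 i A : emb (leg1 i A) = leg1 (f i) A.
Proof.
apply/matrixP => a b; rewrite embE !leg1E !multi_rank !ffunE -mulrnA mulnb.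
congr (_ *+ nat_of_bool _).
apply/andP/agreeP => [[/agreeP H1 /agreeP H2] l li|H].
  have [/codomP [l' El]|/H2//] := boolP (l \in codom f).
  have /H1 : l' != i by apply: contraNneq li => <-; rewrite El.
  by rewrite !ffunE -El.
split; apply/agreeP => l li; first by rewrite !ffunE H // (inj_eq f_inj).
by apply: H; apply: contraNneq li => ->; exact: codom_f.
Qed.

Lemma emb_leg2 i j X : emb (leg2 i j X) = leg2 (f i) (f j) X.
Proof.
apply/matrixP => a b; rewrite embE !leg2E !multi_rank !ffunE -mulrnA mulnb.
congr (_ *+ nat_of_bool _).
apply/andP/agreeP => [[/agreeP H1 /agreeP H2] l /andP[li lj]|H].
  have [/codomP [l' El]|/H2//] := boolP (l \in codom f).
  have /H1 : (l' != i) && (l' != j).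
    by apply/andP; split; [apply: contraNneq li|apply: contraNneq lj] => <-; rewrite El.
  by rewrite !ffunE -El.
split; apply/agreeP => l li; first by rewrite !ffunE H // !(inj_eq f_inj).
by apply: H; apply/andP; split; apply: contraNneq li => ->; exact: codom_f.
Qed.

Lemma emb1 : emb 1 = 1.
Proof.
apply/matrixP => a b; rewrite embE !mxE -mulrnA mulnb; congr (_ *+ nat_of_bool _).
rewrite (inj_eq enum_rank_inj); apply/andP/eqP => [[/eqP ab /push_pull]|->].
  by rewrite -ab push_pull => [/enum_val_inj|]; last exact/agreeP.
by split => //; apply/agreeP.
Qed.

(** Entries of [A] reappear in [emb A] once the remaining legs carry a common value, which [k > 0]
    allows to be read off the index [a]. For [n = 0] and [k = 0] no value exists, and a [1 x 1]
    matrix may be sent to an empty one. *)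
Lemma emb_inj : (0 < k)%N -> injective emb.
Proof.
move=> k0 A B AB; apply/matrixP => a b.
pose d := multi_index a (Ordinal k0).
pose x c := enum_rank (push [ffun=> d] (multi_index c)).
move/matrixP: AB => /(_ (x a) (x b)); rewrite !embE !multi_rank !pull_push.
rewrite !rank_multi; have -> : agree (fun l => l \notin codom f)
   (push [ffun=> d] (multi_index a)) (push [ffun=> d] (multi_index b)).
  apply: agree_trans (push_agree _ _); rewrite agree_sym; exact: push_agree.
by rewrite !mulr1n.
Qed.

Lemma emb_unit A : A \in unitmx -> emb A \in unitmx.
Proof.
move=> Au; have E : emb A *m emb (invmx A) = 1%:M.
  by rewrite mulmxE -embM -mulmxE mulmxV // emb1.
by case: (mulmx1_unit E).
Qed.

Lemma emb_inv A : A \in unitmx -> emb (invmx A) = invmx (emb A).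
Proof.
move=> Au; apply: (can_inj (mulKmx (emb_unit Au))).
by rewrite mulmxV ?emb_unit // mulmxE -embM -mulmxE mulmxV // emb1.
Qed.

End Emb.

Section PartialTrace.
Variable k : nat.
Implicit Types (i j : 'I_k) (Z : 'M[K]_(tdim n k)).

(* The operator id (x) Tr_i Z, with the identity in the factor i. *)
Definition Tr i Z :=
  \sum_p \sum_q leg1 i (delta_mx p q) * Z * leg1 i (delta_mx q p).

Lemma leg1_deltaL i p q Z a b : (leg1 i (delta_mx p q) * Z) a b =
  Z (enum_rank (upd (multi_index a) i q)) b *+ (multi_index a i == p).
Proof.
rewrite mul_mxE (bigD1 (enum_rank (upd (multi_index a) i q))) //= big1 ?addr0.
  rewrite leg1E multi_rank !mxE updE !eqxx andbT.
  suff ->: agree (fun l => l != i) (multi_index a) (upd (multi_index a) i q).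
    by rewrite mulr1n mulr_natl.
  by apply/agreeP => l /negbTE li; rewrite updE li.
move=> u uq; rewrite leg1E !mxE.
case: agreeP => [H|_]; last by rewrite mul0r.
case: eqVneq => _; last by rewrite mul0r.
case: eqVneq => [Eu|_]; last by rewrite mul0r.
case/eqP: uq; apply: enum_val_inj; rewrite enum_rankK; apply/ffunP => l.
by rewrite updE; case: eqP => [->//|/eqP/H].
Qed.

Lemma leg1_deltaR i p q Z a b : (Z * leg1 i (delta_mx p q)) a b =
  Z a (enum_rank (upd (multi_index b) i p)) *+ (multi_index b i == q).
Proof.
rewrite mul_mxE (bigD1 (enum_rank (upd (multi_index b) i p))) //= big1 ?addr0.
  rewrite leg1E multi_rank !mxE updE !eqxx /=.
  suff ->: agree (fun l => l != i) (upd (multi_index b) i p) (multi_index b).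
    by rewrite mulr1n mulr_natr.
  by apply/agreeP => l /negbTE li; rewrite updE li.
move=> u uq; rewrite leg1E !mxE.
case: agreeP => [H|_]; last by rewrite mulr0.
case: (eqVneq _ p) => [Eu|_]; last by rewrite mulr0.
case: eqVneq => _; last by rewrite mulr0.
case/eqP: uq; apply: enum_val_inj; rewrite enum_rankK; apply/ffunP => l.
by rewrite updE; case: eqP => [->//|/eqP/H].
Qed.

Lemma TrE i Z a b : Tr i Z a b =
  (\sum_q Z (enum_rank (upd (multi_index a) i q))
            (enum_rank (upd (multi_index b) i q)))
  *+ (multi_index a i == multi_index b i).
Proof.
rewrite summxE (bigD1 (multi_index a i)) //= [X in _ + X]big1 ?addr0; last first.
  move=> p pa; rewrite summxE big1 // => q _.
  by rewrite -mulrA leg1_deltaL eq_sym (negbTE pa).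
rewrite summxE -sumrMnl; apply: eq_bigr => q _.
by rewrite -mulrA leg1_deltaL eqxx mulr1n leg1_deltaR eq_sym.
Qed.

End PartialTrace.

(** Link between the partial trace that drops a factor and [Tr], which keeps it: the leg [f ord0]
    lies outside the image of [g], so [emb g] is the identity there, as [Tr] is. *)
Lemma emb_ptrace0 k m (f : 'I_k.+1 -> 'I_m) (g : 'I_k -> 'I_m) Z :
  injective f -> (forall l, g l = f (lift ord0 l)) ->
  emb g (ptrace0 Z) = Tr (f ord0) (emb f Z).
Proof.
move=> f_inj gE; apply/matrixP => a b; rewrite embE TrE mxE !multi_rank.
have E s c : pull f (upd s (f ord0) c) = fcons c (pull g s) :> {ffun _ -> 'I_n}.
  apply/ffunP => l; rewrite !ffunE; case: unliftP => [j|] -> /=; last by rewrite eqxx.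
  by rewrite (inj_eq f_inj) ffunE gE eq_sym (negbTE (neq_lift _ _)).
rewrite -!sumrMnl; apply: eq_bigr => c _; rewrite embE !multi_rank !E -mulrnA mulnb.
congr (_ *+ nat_of_bool _); apply/agreeP/andP => [H|[/agreeP H /eqP H0] l lg].
  split; last first.
    apply/eqP/H; apply/codomP => -[l].
    by rewrite gE => /f_inj /eqP; rewrite (negbTE (neq_lift _ _)).
  apply/agreeP => l lf; rewrite !updE; case: eqVneq => // _; apply: H.
  by apply: contra lf => /codomP[l' ->]; rewrite gE codom_f.
have [->//|lf] := eqVneq l (f ord0).
have /H : l \notin codom f.
  apply/codomP => -[l']; case: (unliftP ord0 l') => [j|] -> El.
    by case/negP: lg; rewrite El -gE codom_f.
  by rewrite El eqxx in lf.
by rewrite !updE (negbTE lf).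
Qed.

End Embedding.

(** * Traces, permutations and commutation of legs *)

Section LegCalculus.
Variables (K : numFieldType) (n : nat).
Implicit Types (A B C D Y : 'M[K]_n) (X : 'M[K]_(n * n)).

Lemma flipE p q r s :
  (flip : 'M[K]_(n * n)) (mxtens_index (p, q)) (mxtens_index (r, s)) =
  ((p == s) && (q == r))%:R.
Proof.
rewrite summxE (bigD1 p) //= summxE (bigD1 q) //= !big1 ?addr0.
- by rewrite tensmxE !mxE !eqxx /= -natrM mulnb andbC [r == q]eq_sym [s == p]eq_sym.
- move=> i /negbTE ip; rewrite summxE big1 // => j _.
  by rewrite tensmxE !mxE [p == i]eq_sym ip mul0r.
- move=> i /negbTE iq; rewrite tensmxE !mxE [q == i]eq_sym iq /=.
  by rewrite mulr0.
Qed.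

Lemma flip_mulE X p q t :
  (flip *m X) (mxtens_index (p, q)) t = X (mxtens_index (q, p)) t.
Proof.
rewrite mxE (bigD1 (mxtens_index (q, p))) //= big1 ?addr0.
  by rewrite flipE !eqxx mul1r.
move=> u; case: (mxtens_indexP u) => r s.
rewrite (can_eq (@mxtens_indexK _ _)) xpair_eqE flipE.
by rewrite andbC [s == p]eq_sym [r == q]eq_sym => /negbTE->; rewrite mul0r.
Qed.

Lemma mul_flipE X t p q :
  (X *m flip) t (mxtens_index (p, q)) = X t (mxtens_index (q, p)).
Proof.
rewrite mxE (bigD1 (mxtens_index (q, p))) //= big1 ?addr0.
  by rewrite flipE !eqxx mulr1.
move=> u; case: (mxtens_indexP u) => r s.
rewrite (can_eq (@mxtens_indexK _ _)) xpair_eqE flipE.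
by move=> /negbTE->; rewrite mulr0.
Qed.

Lemma flipM : flip *m flip = 1%:M :> 'M[K]_(n * n).
Proof.
apply/matrixP => a b; case: (mxtens_indexP a) => p q.
case: (mxtens_indexP b) => r s; rewrite flip_mulE flipE mxE.
by rewrite (can_eq (@mxtens_indexK _ _)) xpair_eqE andbC.
Qed.

Lemma op21_tens A B : op21 (A *t B) = B *t A.
Proof.
apply/matrixP => a b; case: (mxtens_indexP a) => p q.
case: (mxtens_indexP b) => r s.
by rewrite mul_flipE flip_mulE !tensmxE mulrC.
Qed.

Lemma op21D X X' : op21 (X + X') = op21 X + op21 X' :> 'M[K]_(n * n).
Proof. by rewrite /op21 mulmxDr mulmxDl. Qed.

Lemma op21Z c X : op21 (c *: X) = c *: op21 X.
Proof. by rewrite /op21 -scalemxAr -scalemxAl. Qed.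

Lemma flip_tens A B : flip *m (A *t B) = (B *t A) *m flip.
Proof. by rewrite -op21_tens /op21 !mulmxA flipM mul1mx. Qed.

Lemma ptrans1E X p q r s :
  ptrans1 X (mxtens_index (p, q)) (mxtens_index (r, s)) =
  X (mxtens_index (r, q)) (mxtens_index (p, s)).
Proof. by rewrite mxE !mxtens_indexK. Qed.

Lemma ptrans1_tens A B : ptrans1 (A *t B) = A^T *t B.
Proof.
apply/matrixP => a b; case: (mxtens_indexP a) => p q.
by case: (mxtens_indexP b) => r s; rewrite ptrans1E !tensmxE mxE.
Qed.

Lemma ptrans1_is_linear : linear (@ptrans1 K n).
Proof.
move=> c A B; apply/matrixP => a b; case: (mxtens_indexP a) => p q.
case: (mxtens_indexP b) => r s; rewrite ptrans1E.
by rewrite [RHS]mxE [in RHS]mxE !ptrans1E !mxE.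
Qed.

HB.instance Definition _ :=
  GRing.isLinear.Build K 'M[K]_(n * n) 'M[K]_(n * n) _ (@ptrans1 K n)
    ptrans1_is_linear.

Lemma ptrans1K : involutive (@ptrans1 K n).
Proof.
move=> X; apply/matrixP => a b; case: (mxtens_indexP a) => p q.
by case: (mxtens_indexP b) => r s; rewrite !ptrans1E.
Qed.

Lemma ptrans1_1 : ptrans1 (1%:M : 'M[K]_(n * n)) = 1%:M.
Proof. by rewrite -tens11 ptrans1_tens trmx1. Qed.

Lemma ptrace1_tens A B : ptrace1 (A *t B) = \tr A *: B.
Proof.
apply/matrixP => i j; rewrite !mxE mulr_suml.
by apply: eq_bigr => a _; rewrite tensmxE.
Qed.

Lemma ptrace1_is_linear : linear (@ptrace1 K n).
Proof.
move=> c A B; apply/matrixP => a b; rewrite !mxE mulr_sumr -big_split.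
by apply: eq_bigr => i _; rewrite !mxE.
Qed.

HB.instance Definition _ :=
  GRing.isLinear.Build K 'M[K]_(n * n) 'M[K]_n _ (@ptrace1 K n)
    ptrace1_is_linear.

Section Fix.
Variable k : nat.
Implicit Types (i j l : 'I_k) (Z U V : 'M[K]_(tdim n k)).

(* A one-constructor type rather than a plain definition, so that unification
   never unfolds it. *)
Variant idle i Z : Prop :=
  Idle of forall A, leg1 i A * Z = Z * leg1 i A.

Lemma idleE i Z A : idle i Z -> leg1 i A * Z = Z * leg1 i A.
Proof. by case. Qed.

Lemma idleM i Z U : idle i Z -> idle i U -> idle i (Z * U).
Proof. by move=> [fZ] [fU]; split=> A; rewrite mulrA fZ -mulrA fU mulrA. Qed.

Lemma idleD i Z U : idle i Z -> idle i U -> idle i (Z + U).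
Proof. by move=> [fZ] [fU]; split=> A; rewrite mulrDl mulrDr fZ fU. Qed.

Lemma idleZ i c Z : idle i Z -> idle i (c *: Z).
Proof. by move=> [fZ]; split=> A; rewrite mul_mxZl mul_mxZr fZ. Qed.

Lemma idle_sum i (I : Type) (r : seq I) (P : pred I) F :
  (forall x, P x -> idle i (F x)) -> idle i (\sum_(x <- r | P x) F x).
Proof.
move=> H; apply: (big_ind (idle i)) => //; last exact: idleD.
by split=> A; rewrite mulr0 mul0r.
Qed.

Lemma idle_leg1 i j A : i != j -> idle i (leg1 j A).
Proof. by move=> ij; split=> B; rewrite leg1C. Qed.

Lemma idle_leg2 l i j X : i != j -> l != i -> l != j -> idle l (leg2 i j X).
Proof.
move=> ij li lj; move: X; apply: tens_span => [A B|X X'|c X].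
- by rewrite leg2_tens //; apply: idleM; apply: idle_leg1.
- by rewrite linearD; apply: idleD.
- by rewrite linearZ; apply: idleZ.
Qed.

Lemma Tr_is_linear i : linear (@Tr K n k i).
Proof.
move=> c Z U; rewrite /Tr scaler_sumr -big_split; apply: eq_bigr => p _ /=.
rewrite scaler_sumr -big_split; apply: eq_bigr => q _ /=.
by rewrite mulrDr mulrDl mul_mxZr mul_mxZl.
Qed.

HB.instance Definition _ i :=
  GRing.isLinear.Build K 'M[K]_(tdim n k) 'M[K]_(tdim n k) _ (@Tr K n k i)
    (Tr_is_linear i).

Lemma idle_Tr i j Z : i != j -> idle i Z -> idle i (Tr j Z).
Proof.
move=> ij fZ; do 2!apply: idle_sum => ? _.
by apply: idleM; [apply: idleM => //|]; apply: idle_leg1.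
Qed.

Lemma TrMl i U Z : idle i U -> Tr i (U * Z) = U * Tr i Z.
Proof.
move=> [fU]; rewrite mulr_sumr; apply: eq_bigr => p _.
by rewrite mulr_sumr; apply: eq_bigr => q _; rewrite !mulrA fU.
Qed.

Lemma TrMr i U Z : idle i U -> Tr i (Z * U) = Tr i Z * U.
Proof.
move=> [fU]; rewrite mulr_suml; apply: eq_bigr => p _.
by rewrite mulr_suml; apply: eq_bigr => q _; rewrite -!mulrA fU.
Qed.

Lemma leg1_delta_sum i A :
  leg1 i A = \sum_p \sum_q A p q *: leg1 i (delta_mx p q).
Proof.
rewrite {1}(matrix_sum_delta A) linear_sum; apply: eq_bigr => p _ /=.
by rewrite linear_sum; apply: eq_bigr => q _ /=; rewrite linearZ.
Qed.

Lemma leg1_deltaM i p q r s :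
  leg1 i (delta_mx p q) * leg1 i (delta_mx r s) =
  (leg1 i (delta_mx p s) : 'M[K]_(tdim n k)) *+ (q == r).
Proof.
by rewrite -leg1M mul_delta_mx_cond raddfMn.
Qed.

Lemma sum_pick (F : 'I_n -> 'M[K]_(tdim n k)) p :
  \sum_q F q *+ (p == q) = F p.
Proof.
rewrite (bigD1 p) //= eqxx mulr1n big1 ?addr0 // => q /negbTE.
by rewrite eq_sym => ->.
Qed.

(** By linearity [A] is a matrix unit [E_rs]; both sides then reduce to [\sum_p E_ps Z E_rp] in the
    leg [i]. *)
Lemma Tr_cyc i A Z : Tr i (leg1 i A * Z) = Tr i (Z * leg1 i A).
Proof.
rewrite leg1_delta_sum mulr_suml mulr_sumr !linear_sum; apply: eq_bigr => r _ /=.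
rewrite mulr_suml mulr_sumr !linear_sum; apply: eq_bigr => s _ /=.
rewrite mul_mxZl mul_mxZr !linearZ; congr (_ *: _).
transitivity (\sum_p leg1 i (delta_mx p s) * Z * leg1 i (delta_mx r p)).
  apply: eq_bigr => p _.
  under eq_bigr => q _ do rewrite mulrA leg1_deltaM mulrnAl mulrnAl eq_sym.
  exact: (sum_pick (fun q => leg1 i (delta_mx p s) * Z * leg1 i (delta_mx q p))).
apply: eq_bigr => p _.
under eq_bigr => q _ do rewrite -!mulrA leg1_deltaM mulrnAr mulrnAr mulrA.
by rewrite (sum_pick (fun q => leg1 i (delta_mx p q) * Z * leg1 i (delta_mx r p))).
Qed.

Lemma TrC i j Z : i != j -> Tr i (Tr j Z) = Tr j (Tr i Z).
Proof.
move=> ij; rewrite /Tr.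
under eq_bigr do under eq_bigr do rewrite mulr_sumr mulr_suml.
under [RHS]eq_bigr do under eq_bigr do rewrite mulr_sumr mulr_suml.
under eq_bigr do rewrite exchange_big /=.
rewrite exchange_big /=; apply: eq_bigr => r _.
under eq_bigr do under eq_bigr do rewrite mulr_sumr mulr_suml.
under [RHS]eq_bigr do under eq_bigr do rewrite mulr_sumr mulr_suml.
under eq_bigr do rewrite exchange_big /=.
rewrite exchange_big /=; apply: eq_bigr => s _.
apply: eq_bigr => p _; apply: eq_bigr => q _.
by rewrite !mulrA (leg1C _ _ ij) -!mulrA (leg1C _ _ ij).
Qed.

Lemma idle_comm2 i j X Z : i != j -> idle i Z -> idle j Z ->
  leg2 i j X * Z = Z * leg2 i j X.
Proof.
move=> ij [fi] [fj]; move: X; apply: tens_span => [A B|X X'|c X].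
- by rewrite leg2_tens // -mulrA fj !mulrA fi.
- by rewrite linearD mulrDl mulrDr => -> ->.
- by rewrite linearZ mul_mxZl mul_mxZr => ->.
Qed.

(** A single trace is cyclic only for operators on its own leg. For two legs both traces are used:
    on [A *t B] each moves its own factor. *)
Lemma Tr2_cyc i j X Z : i != j ->
  Tr i (Tr j (leg2 i j X * Z)) = Tr i (Tr j (Z * leg2 i j X)).
Proof.
move=> ij; move: X; apply: tens_span => [A B|X X'|c X].
- have fA : idle j (leg1 i A) by apply: idle_leg1; rewrite eq_sym.
  rewrite leg2_tens // -mulrA (TrMl _ fA) (Tr_cyc j) Tr_cyc -(TrMr _ fA).
  by rewrite (leg1C _ _ ij) mulrA.
- by rewrite linearD mulrDl mulrDr !linearD /= => -> ->.
- by rewrite linearZ mul_mxZl mul_mxZr !linearZ /= => ->.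
Qed.

Lemma leg2_op21 i j X : i != j -> leg2 i j (op21 X) = leg2 j i X.
Proof.
move=> ij; have ji : j != i by rewrite eq_sym.
move: X; apply: tens_span => [A B|X X'|c X].
- by rewrite op21_tens (leg2_tens _ _ ij) (leg2_tens _ _ ji) leg1C.
- by rewrite op21D !linearD /= => -> ->.
- by rewrite op21Z !linearZ /= => ->.
Qed.

Definition swap i j : 'M[K]_(tdim n k) := leg2 i j flip.

Lemma swap_leg1 i j A : i != j -> swap i j * leg1 i A = leg1 j A * swap i j.
Proof.
move=> ij; rewrite -(leg2_leg_1 _ ij) -(leg2_leg_2 _ ij) -!leg2M //.
by rewrite flip_tens.
Qed.

Lemma swap_leg1' i j A : i != j -> swap i j * leg1 j A = leg1 i A * swap i j.
Proof.
move=> ij; rewrite -(leg2_leg_1 _ ij) -(leg2_leg_2 _ ij) -!leg2M //.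
by rewrite flip_tens.
Qed.

Lemma swap_leg2l i j l X : i != j -> l != i -> l != j ->
  swap i j * leg2 i l X = leg2 j l X * swap i j.
Proof.
move=> ij li lj; have il : i != l by rewrite eq_sym.
have jl : j != l by rewrite eq_sym.
move: X; apply: tens_span => [A B|X X'|c X].
- rewrite (leg2_tens _ _ il) (leg2_tens _ _ jl) mulrA swap_leg1 // -!mulrA.
  by congr (_ * _); apply: idle_comm2 => //; apply: idle_leg1.
- by rewrite !linearD mulrDl mulrDr => -> ->.
- by rewrite !linearZ mul_mxZl mul_mxZr => ->.
Qed.

Lemma swap_leg2r i j l X : i != j -> l != i -> l != j ->
  swap i j * leg2 l i X = leg2 l j X * swap i j.
Proof.
move=> ij li lj; have il : i != l by rewrite eq_sym.
have jl : j != l by rewrite eq_sym.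
by rewrite -(leg2_op21 _ il) -(leg2_op21 _ jl) swap_leg2l.
Qed.

Lemma Tr_leg1 i A : Tr i (leg1 i A) = (\tr A)%:M.
Proof.
transitivity (\sum_p \sum_q leg1 i (delta_mx p p) *+ (p == p) *
   (A q q)%:M : 'M[K]_(tdim n k)); last first.
  under eq_bigr do rewrite eqxx mulr1n -mulr_sumr -[X in _ * X]raddf_sum.
  rewrite -mulr_suml -raddf_sum /=.
  rewrite (_ : \sum_p _ = 1%:M) ?leg1_1 ?mul1r //.
  rewrite [RHS]matrix_sum_delta; apply: eq_bigr => p _.
  rewrite (bigD1 p) //= big1 ?addr0; first by rewrite mxE eqxx scale1r.
  by move=> q; rewrite eq_sym mxE => /negbTE->; rewrite scale0r.
apply: eq_bigr => p _; apply: eq_bigr => q _.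
rewrite eqxx mulr1n -!leg1M -mulmxE mul_mx_scalar -linearZ; congr leg1.
apply/matrixP => r s; rewrite [RHS]mxE.
rewrite mxE (bigD1 q) //= big1 ?addr0 => [|u /negbTE uq]; last first.
  by rewrite [delta_mx _ _ _ _]mxE uq mulr0.
rewrite mxE (bigD1 q) //= big1 ?addr0 => [|u /negbTE uq]; last first.
  by rewrite [delta_mx _ _ _ _]mxE uq andbF mul0r.
rewrite !mxE !eqxx andbT /= mulrAC -natrM mulnb mulrC; congr (_ * _%:R).
Qed.

Lemma leg1_ptrace1 i j X : i != j -> leg1 j (ptrace1 X) = Tr i (leg2 i j X).
Proof.
move=> ij; move: X; apply: tens_span => [A B|X X'|c X].
- rewrite leg2_tens // TrMr ?Tr_leg1; last exact: idle_leg1.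
  by rewrite ptrace1_tens linearZ -mulmxE mul_scalar_mx.
- by rewrite !linearD /= => -> ->.
- by rewrite !linearZ /= => ->.
Qed.

Lemma Tr_swap i j : i != j -> Tr i (swap i j) = 1.
Proof.
move=> ij; rewrite -leg1_ptrace1 // -(leg1_1 _ _ j); congr leg1.
apply/matrixP => p q; rewrite !mxE.
under eq_bigr do rewrite flipE.
rewrite (bigD1 p) //= big1 ?addr0 => [|a /negbTE ap]; last first.
  by rewrite [p == a]eq_sym ap andbF.
by rewrite eqxx andbT.
Qed.

Lemma leg1_boundary i j Y X : i != j ->
  leg1 j (ptrace1 (leg_1 Y *m flip *m X)) =
  Tr i (leg1 i Y * swap i j * leg2 i j X).
Proof. by move=> ij; rewrite (leg1_ptrace1 _ ij) !leg2M // leg2_leg_1. Qed.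

(* The product (a (x) b, c (x) d) |-> ca (x) bd, for which the inverse of R is
   R~. *)
Definition xmul X X' : 'M[K]_(n * n) := ptrans1 (ptrans1 X *m ptrans1 X').

Lemma xmul_tens A B C D : xmul (A *t B) (C *t D) = (C *m A) *t (B *m D).
Proof. by rewrite /xmul !ptrans1_tens tensmx_mul ptrans1_tens trmx_mul !trmxK. Qed.

Lemma xmulDl X X' X'' : xmul (X + X') X'' = xmul X X'' + xmul X' X''.
Proof. by rewrite /xmul linearD mulmxDl linearD. Qed.
Lemma xmulDr X X' X'' : xmul X'' (X + X') = xmul X'' X + xmul X'' X'.
Proof. by rewrite /xmul linearD mulmxDr linearD. Qed.
Lemma xmulZl c X X' : xmul (c *: X) X' = c *: xmul X X'.
Proof. by rewrite /xmul linearZ -scalemxAl linearZ. Qed.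
Lemma xmulZr c X X' : xmul X (c *: X') = c *: xmul X X'.
Proof. by rewrite /xmul linearZ -scalemxAr linearZ. Qed.

(** For [X = A *t B] and [X' = C *t D], cyclicity brings [C] round to the left of [A], while [D]
    commutes with [Z] and joins [B] on its right: this is [xmul]. *)
Lemma Tr_sandwich i j X X' Z : i != j -> idle j Z ->
  Tr i (leg2 i j X * Z * leg2 i j X') = Tr i (leg2 i j (xmul X X') * Z).
Proof.
move=> ij [fZ]; move: X X'; apply: tens_bilin_span => [A B C D|X Y W|c X W|X Y W|c X W].
- rewrite xmul_tens !leg2_tens // !leg1M (leg1C C D ij) -!mulrA [RHS]Tr_cyc.
  by rewrite -!mulrA [Z * (_ * _)]mulrA -fZ -!mulrA.
- by rewrite xmulDl !linearD /= !mulrDl !linearD /= => -> ->.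
- by rewrite xmulZl !linearZ /= !mul_mxZl !linearZ /= => ->.
- by rewrite xmulDr !linearD /= mulrDr mulrDl !linearD /= => -> ->.
- by rewrite xmulZr !linearZ /= mul_mxZr mul_mxZl !linearZ /= => ->.
Qed.

(** For [X = A *t B] take [g Z = A_j Z B_l]: past the swap [A_j] becomes [A_i], so that [A] and [B]
    reach [X'] from opposite sides. For general [X], [g] is a linear combination of such maps. It is
    chosen before [U], [V] and [X'], as the injectivity argument requires. *)
Lemma Tr_strip j l X : exists g : 'M[K]_(tdim n k) -> 'M[K]_(tdim n k),
  forall i U V X', i != j -> i != l -> idle i U -> idle l V ->
  g (Tr i (swap i j * U * leg2 i l X' * V)) =
  Tr i (swap i j * U * leg2 i l (xmul X' X) * V).
Proof.
move: X; apply: tens_span => [A B|X Y [g Hg] [h Hh]|c X [g Hg]].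
- exists (fun Z => leg1 j A * Z * leg1 l B) => i U V X' ij il [fU] [fV].
  rewrite -TrMl; last exact: idle_leg1.
  rewrite -TrMr; last exact: idle_leg1.
  congr (Tr i _); rewrite !mulrA -swap_leg1 // -[RHS]mulrA -[LHS]mulrA -fV.
  rewrite -!mulrA; congr (_ * _); rewrite !mulrA fU -!mulrA; congr (_ * _).
  rewrite !mulrA; congr (_ * _).
  rewrite -!(leg2_leg_1 _ il) -!(leg2_leg_2 _ il) -!leg2M //; congr leg2.
  move: X'; apply: tens_span => [C D|X' Y|c X'].
  + by rewrite xmul_tens !tensmx_mul !(mulmx1, mul1mx).
  + by rewrite xmulDl mulmxDr mulmxDl => -> ->.
  + by rewrite xmulZl -scalemxAr -scalemxAl => ->.
- exists (fun Z => g Z + h Z) => i U V X' ij il fU fV.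
  by rewrite Hg // Hh // xmulDr linearD mulrDr mulrDl linearD.
- exists (fun Z => c *: g Z) => i U V X' ij il fU fV.
  by rewrite Hg // xmulZr linearZ /= mul_mxZr mul_mxZl linearZ.
Qed.

End Fix.
End LegCalculus.

Arguments swap {K n k}.

(** * The dual reflection equation *)

Section DualReflection.
Variables (K : numFieldType) (n : nat).
Implicit Types (A B C D : 'M[K]_n) (X Y : 'M[K]_(n * n)).

(** The spectral parameters are left out: each instance [R (u / w)], [R u], [R w] becomes a
    condition on three matrices. *)
Definition yb3 (X Y Z : 'M[K]_(n * n)) :=
  leg2 (inord 0 : 'I_3) (inord 1) X *m leg2 (inord 0) (inord 2) Y
    *m leg2 (inord 1) (inord 2) Z =
  leg2 (inord 1) (inord 2) Z *m leg2 (inord 0) (inord 2) Y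
    *m leg2 (inord 0) (inord 1) X.

Section Fix.
Variable k : nat.
Implicit Types (i j l : 'I_k) (Z U V : 'M[K]_(tdim n k)).

Lemma yb3_legs i j l X Y (Z : 'M[K]_(n * n)) : yb3 X Y Z -> uniq [:: i; j; l] ->
  leg2 i j X * leg2 i l Y * leg2 j l Z = leg2 j l Z * leg2 i l Y * leg2 i j X.
Proof.
rewrite /= !inE negb_or andbT => E /andP[/andP[/negbTE ij /negbTE il] /negbTE jl].
pose f (u : 'I_3) := tnth [tuple i; j; l] u.
have f_inj : injective f.
  have fu : uniq [tuple i; j; l] by rewrite /= !inE ij il jl.
  move=> u v; rewrite /f !(tnth_nth i) => /eqP.
  by rewrite nth_uniq // => /eqP/val_inj.
have -> : i = f (inord 0) by rewrite /f (tnth_nth i) inordK.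
have -> : j = f (inord 1) by rewrite /f (tnth_nth i) inordK.
have -> : l = f (inord 2) by rewrite /f (tnth_nth i) inordK.
by rewrite -!(emb_leg2 f_inj) -!(embM f_inj) -!mulmxE E.
Qed.

Lemma swapC i j : i != j -> swap i j = swap j i :> 'M[K]_(tdim n k).
Proof.
move=> ij; rewrite /swap -(leg2_op21 _ ij); congr leg2.
by rewrite /op21 flipM mul1mx.
Qed.

Lemma swap_leg2l' i j l X : i != j -> l != i -> l != j ->
  swap i j * leg2 j l X = leg2 i l X * swap i j.
Proof. by move=> ij li lj; rewrite swapC // swap_leg2l // eq_sym. Qed.

Lemma swap_leg2r' i j l X : i != j -> l != i -> l != j ->
  swap i j * leg2 l j X = leg2 l i X * swap i j.
Proof. by move=> ij li lj; rewrite swapC // swap_leg2r // eq_sym. Qed.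

Definition tilde X : 'M[K]_(n * n) := ptrans1 (invmx (ptrans1 X)).

Lemma xmul_tildel X : ptrans1 X \in unitmx -> xmul (tilde X) X = 1%:M.
Proof. by move=> Xu; rewrite /xmul ptrans1K mulVmx // ptrans1_1. Qed.

Lemma xmul_tilder X : ptrans1 X \in unitmx -> xmul X (tilde X) = 1%:M.
Proof. by move=> Xu; rewrite /xmul ptrans1K mulmxV // ptrans1_1. Qed.

Lemma Tr_tilde i j X Z : i != j -> ptrans1 X \in unitmx -> idle j Z ->
  Tr i (leg2 i j (tilde X) * Z * leg2 i j X) = Tr i Z.
Proof.
by move=> ij Xu fZ; rewrite Tr_sandwich // xmul_tildel // leg2_1 // mul1r.
Qed.

(** Stripping with [tilde X] and then with [tilde X'] reduces both factors to 1. What remains is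
    [Tr_i (P_ij Z)], which is [Z] because [Tr_i P_ij = 1]. *)
Lemma Tr_boundary_inj i j l m X X' : i != j -> i != l -> i != m -> l != m ->
  ptrans1 X \in unitmx -> ptrans1 X' \in unitmx ->
  exists g : 'M[K]_(tdim n k) -> 'M[K]_(tdim n k), forall Z, idle i Z ->
    g (Tr i (swap i j * Z * leg2 i l X * leg2 i m X')) = Z.
Proof.
move=> ij il im lm Xu X'u.
have [g Hg] := Tr_strip j l (tilde X); have [h Hh] := Tr_strip j m (tilde X').
exists (h \o g) => Z fZ /=; rewrite Hg //; last by apply: idle_leg2; rewrite // eq_sym.
rewrite xmul_tilder // leg2_1 // mulr1 -[swap i j * Z * _]mulr1.
rewrite Hh //; last by split=> A; rewrite mulr1 mul1r.
rewrite xmul_tilder // leg2_1 // !mulr1 TrMr //.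
by rewrite Tr_swap // mul1r.
Qed.

End Fix.

(** In a left-associated product two adjacent factors form a subterm only at the front; these forms
    allow rewriting them after a prefix [z]. *)
Lemma mulr_eq2 (S : pzRingType) (u v u' v' : S) : u * v = u' * v' ->
  forall z, z * u * v = z * u' * v'.
Proof. by move=> E z; rewrite -!mulrA E. Qed.

Lemma mulr_eq3 (S : pzRingType) (u v w u' v' w' : S) : u * v * w = u' * v' * w' ->
  forall z, z * u * v * w = z * u' * v' * w'.
Proof. by move=> E z; rewrite -!mulrA; congr (_ * _); rewrite !mulrA. Qed.

(** * The double boundary map on four legs *)

Section FourLegs.
Variables (k : nat) (a b c d : 'I_k).
Hypotheses (ab : a != b) (ac : a != c) (ad : a != d).
Hypotheses (bc : b != c) (bd : b != d) (cd : c != d).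
(** These stand for [R(x/y)], [R(xy)], [R(x^2)], [R(y^2)] and for the values of [K']; then [Kpx] and
    [Kpy] are those of [K+]. The legs [c], [d] carry the equation, and [a], [b] are traced out. *)
Variables (X R2 Rx Ry : 'M[K]_(n * n)) (Kx Ky : 'M[K]_n).
Hypotheses (R2u : ptrans1 R2 \in unitmx).
Hypotheses (Rxu : ptrans1 Rx \in unitmx) (Ryu : ptrans1 Ry \in unitmx).
Hypotheses (Y1 : yb3 X Rx R2) (Y2 : yb3 X R2 Ry).
Hypotheses (Y3 : yb3 Ry R2 X) (Y4 : yb3 R2 Rx X).

Let Kpx := ptrace1 (leg_1 Kx *m flip *m Rx).
Let Kpy := ptrace1 (leg_1 Ky *m flip *m Ry).
Local Notation T2 := (tilde R2).
Let ba : b != a. Proof. by rewrite eq_sym. Qed.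
Let ca : c != a. Proof. by rewrite eq_sym. Qed.
Let da : d != a. Proof. by rewrite eq_sym. Qed.
Let cb : c != b. Proof. by rewrite eq_sym. Qed.
Let db : d != b. Proof. by rewrite eq_sym. Qed.
Let dc : d != c. Proof. by rewrite eq_sym. Qed.

Ltac idle := repeat match goal with
  | |- idle _ (_ * _) => apply: idleM
  | |- idle _ (leg1 _ _) => apply: idle_leg1
  | |- idle _ (leg2 _ _ _) => apply: idle_leg2
  | |- idle _ (swap _ _) => apply: idle_leg2
  | H : is_true ?P |- is_true ?P => exact: H
  end.
Ltac com := match goal with
  | |- leg1 _ _ * _ = _ => apply: idleE
  | |- _ = leg1 _ _ * _ => apply/esym/idleE
  | |- _ => apply: idle_comm2
  end; idle.

Let G (U : 'M[K]_(tdim n k)) :=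
  Tr a (swap a c * Tr b (swap b d * U * leg2 b c R2 * leg2 b d Ry)
        * leg2 a c Rx * leg2 a d R2).

Lemma boundary2_inj U U' : idle a U -> idle b U -> idle a U' -> idle b U' ->
  G U = G U' -> U = U'.
Proof.
move=> fa fb fa' fb' GA.
have [g Hg] := @Tr_boundary_inj k b d c d R2 Ry bd bc bd cd R2u Ryu.
have [h Hh] := @Tr_boundary_inj k a c c d Rx R2 ac ac ad cd Rxu R2u.
have fT V : idle a V ->
    idle a (Tr b (swap b d * V * leg2 b c R2 * leg2 b d Ry)).
  move=> fV; apply: (idle_Tr ab).
  do 2!(apply: idleM; last exact: idle_leg2).
  by apply: idleM; [exact: idle_leg2|exact: fV].
by rewrite -(Hg _ fb) -(Hh _ (fT _ fa)) -/(G U) GA /G (Hh _ (fT _ fa')) (Hg _ fb').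
Qed.

(** [X_dc] leaves each trace on the right by a Yang-Baxter move. In the trace over [b] the swap
    turns [T2_dc] into [T2_bc], which cancels against [R2_bc] and leaves [Kpy]; in the trace over
    [a] it turns [R2_ad] into [R2_cd] and leaves [Kpx]. *)
Lemma boundary2_right :
  G (leg1 c Kx * leg2 d c T2 * leg1 d Ky * leg2 d c X) =
  leg1 d Kpy * leg2 c d R2 * leg1 c Kpx * leg2 d c X.
Proof.
have E3 : leg2 d c X * leg2 b c R2 * leg2 b d Ry =
          leg2 b d Ry * leg2 b c R2 * leg2 d c X.
  by rewrite (yb3_legs Y3) //= !inE negb_or bd bc dc.
have E4 : leg2 d c X * leg2 a c Rx * leg2 a d R2 =
          leg2 a d R2 * leg2 a c Rx * leg2 d c X.
  by rewrite (yb3_legs Y4) //= !inE negb_or ad ac dc.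
rewrite /G !mulrA (mulr_eq3 E3).
rewrite [swap b d * leg1 c Kx](_ : _ = leg1 c Kx * swap b d); last by com.
rewrite (mulr_eq2 (swap_leg2l' _ bd cb cd)) (mulr_eq2 (swap_leg1' _ bd)).
rewrite (@TrMr _ _ _ b); last by idle.
rewrite -!mulrA (@TrMl _ _ _ b); last by idle.
rewrite !mulrA -[leg2 b c T2 * _ * _ * _]mulrA.
rewrite -[leg2 b c T2 * _ * _]mulrA [leg1 b Ky * _]mulrA.
rewrite Tr_tilde //; last by idle.
rewrite -leg1_boundary // -/Kpy (mulr_eq3 E4).
rewrite (mulr_eq2 (_ : leg1 c Kx * leg1 d Kpy = leg1 d Kpy * leg1 c Kx));
  last by com.
rewrite [swap a c * leg1 d _](_ : _ = leg1 d Kpy * swap a c); last by com.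
rewrite (mulr_eq2 (swap_leg1' _ ac)) (mulr_eq2 (swap_leg2l _ ac da dc)).
rewrite (mulr_eq2 (_ : leg1 a Kx * leg2 c d R2 = leg2 c d R2 * leg1 a Kx));
  last by com.
rewrite (@TrMr _ _ _ a); last by idle.
rewrite -!mulrA (@TrMl _ _ _ a); last by idle.
rewrite (@TrMl _ _ _ a); last by idle.
by rewrite !mulrA -leg1_boundary.
Qed.

(** With [X_cd] on the left, the swaps turn it into [X_ab], which the double trace moves to the
    right end. Two Yang-Baxter moves bring it back through the [R] factors, reversing their order,
    and the swaps restore [X_cd]. *)
Lemma boundary2_left :
  G (leg2 c d X * leg1 d Ky * leg2 c d T2 * leg1 c Kx) =
  leg2 c d X * leg1 c Kpx * leg2 d c R2 * leg1 d Kpy.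
Proof.
have E1 : leg2 b c R2 * leg2 a c Rx * leg2 a b X =
          leg2 a b X * leg2 a c Rx * leg2 b c R2.
  by rewrite (yb3_legs Y1) //= !inE negb_or ab ac bc.
have E2 : leg2 b d Ry * leg2 a d R2 * leg2 a b X =
          leg2 a b X * leg2 a d R2 * leg2 b d Ry.
  by rewrite (yb3_legs Y2) //= !inE negb_or ab ad bd.
rewrite /G -(@TrMl _ _ _ b); last by idle.
rewrite -(@TrMr _ _ _ b); last by idle.
rewrite -(@TrMr _ _ _ b); last by idle.
rewrite !mulrA.
rewrite (mulr_eq2 (swap_leg2r' _ bd cb cd)) (swap_leg2l' _ ac ba bc).
rewrite (mulr_eq2 (swap_leg1' _ bd)).
rewrite (mulr_eq2 (_ : swap a c * leg1 b Ky = leg1 b Ky * swap a c));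
  last by com.
rewrite (mulr_eq2 (swap_leg2r' _ bd cb cd)) (mulr_eq2 (swap_leg2l' _ ac ba bc)).
rewrite (mulr_eq2 (_ : swap b d * leg1 c Kx = leg1 c Kx * swap b d));
  last by com.
rewrite (mulr_eq2 (swap_leg1' _ ac)).
rewrite -!mulrA Tr2_cyc // !mulrA.
rewrite (mulr_eq2 (_ : leg2 b d Ry * leg2 a c Rx = leg2 a c Rx * leg2 b d Ry));
  last by com.
rewrite (mulr_eq3 E2) (mulr_eq3 E1).
rewrite (mulr_eq2 (swap_leg2r _ bd ab ad)) (mulr_eq2 (swap_leg2l _ ac da dc)).
rewrite (mulr_eq2 (_ : leg1 a Kx * leg2 c d X = leg2 c d X * leg1 a Kx));
  last by com.
rewrite (mulr_eq2 (_ : leg2 a b T2 * leg2 c d X = leg2 c d X * leg2 a b T2));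
  last by com.
rewrite [leg1 b Ky * leg2 c d X](_ : _ = leg2 c d X * leg1 b Ky); last by com.
rewrite (mulr_eq2 (_ : swap a c * swap b d = swap b d * swap a c));
  last by com.
rewrite (mulr_eq2 (_ : leg1 a Kx * swap b d = swap b d * leg1 a Kx));
  last by com.
(* Behind the swap [T2_ab] becomes [T2_ad]; with the traces exchanged, the one over [a] cancels it
   against [R2_ad]. *)
rewrite (mulr_eq2 (esym (swap_leg2r' _ bd ab ad))) TrC //.
rewrite (@TrMr _ _ _ a); last by idle.
rewrite -!mulrA 3?(@TrMl _ _ _ a); try by idle.
rewrite (_ : leg2 a d T2 * _ =
  leg2 a d T2 * (leg1 a Kx * swap a c * leg2 a c Rx * leg2 b c R2) * leg2 a d R2);
  last by rewrite !mulrA.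
rewrite Tr_tilde //; last by idle.
rewrite (@TrMr _ _ _ a); last by idle.
rewrite -leg1_boundary // -/Kpx.
rewrite !mulrA.
rewrite (mulr_eq2 (_ : swap b d * leg1 c Kpx = leg1 c Kpx * swap b d));
  last by com.
rewrite (mulr_eq2 (_ : leg1 b Ky * leg1 c Kpx = leg1 c Kpx * leg1 b Ky));
  last by com.
rewrite (mulr_eq2 (swap_leg2l _ bd cb cd)).
rewrite (mulr_eq2 (_ : leg1 b Ky * leg2 d c R2 = leg2 d c R2 * leg1 b Ky));
  last by com.
do 3!(rewrite -?mulrA (@TrMl _ _ _ b); last by idle).
by rewrite !mulrA -leg1_boundary.
Qed.

End FourLegs.

Lemma leg2_inj k (i j : 'I_k) : i != j -> injective (@leg2 K n k i j).
Proof.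
move=> ij X X' E; apply/matrixP => s t.
case: (mxtens_indexP s) => p q; case: (mxtens_indexP t) => p' q'.
pose u := [ffun l => if l == i then p else if l == j then q else p].
pose w := [ffun l => if l == i then p' else if l == j then q' else p].
move/matrixP: E => /(_ (enum_rank u) (enum_rank w)).
rewrite !leg2E !multi_rank !ffunE !eqxx [j == i]eq_sym (negbTE ij).
suff -> : agree (fun l => (l != i) && (l != j)) u w by rewrite !mulr1n.
by apply/agreeP => l /andP[/negbTE li /negbTE lj]; rewrite !ffunE li lj.
Qed.

(* K' is recovered from K+ = phi_R(K'), and the map that sends an operator A on
   legs 1 and 2 to
     Tr_a P_a1 (Tr_b P_b2 A_12 R_b1(xy) R_b2(y^2)) R_a1(x^2) R_a2(xy)
   is injective and turns the two sides of the dual equation into those of the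
   reflection equation. *)
Lemma dual_reflection (X R2 Rx Ry : 'M[K]_(n * n)) (Kx Ky : 'M[K]_n)
    (Kpx := ptrace1 (leg_1 Kx *m flip *m Rx))
    (Kpy := ptrace1 (leg_1 Ky *m flip *m Ry)) :
  ptrans1 R2 \in unitmx -> ptrans1 Rx \in unitmx -> ptrans1 Ry \in unitmx ->
  yb3 X Rx R2 -> yb3 X R2 Ry -> yb3 Ry R2 X -> yb3 R2 Rx X ->
  X *m leg_1 Kpx *m op21 R2 *m leg_2 Kpy =
    leg_2 Kpy *m R2 *m leg_1 Kpx *m op21 X ->
  X *m leg_2 Ky *m tilde R2 *m leg_1 Kx =
    leg_1 Kx *m op21 (tilde R2) *m leg_2 Ky *m op21 X.
Proof.
move=> R2u Rxu Ryu Y1 Y2 Y3 Y4 E.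
pose a : 'I_4 := inord 0; pose b : 'I_4 := inord 1.
pose c : 'I_4 := inord 2; pose d : 'I_4 := inord 3.
have ne (i j : nat) : (i < 4)%N -> (j < 4)%N -> i != j ->
    (inord i : 'I_4) != inord j.
  by move=> i4 j4; apply: contraNneq => /(congr1 val); rewrite /= !inordK // => ->.
have [ab ac ad] : [/\ a != b, a != c & a != d] by split; apply: ne.
have [bc bd cd] : [/\ b != c, b != d & c != d] by split; apply: ne.
have [ca cb da db] : [/\ c != a, c != b, d != a & d != b] by split; apply: ne.
have M4 (A B C D : 'M[K]_(n * n)) : leg2 c d (A *m B *m C *m D) =
    leg2 c d A * leg2 c d B * leg2 c d C * leg2 c d D by rewrite !(leg2M _ _ cd).
apply: (leg2_inj cd).
rewrite !M4 !(leg2_leg_1 _ cd) !(leg2_leg_2 _ cd) !(leg2_op21 _ cd).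
have dc : d != c by rewrite eq_sym.
apply: (boundary2_inj ab ac ad bc bd cd R2u Rxu Ryu).
- by do !apply: idleM; first [apply: idle_leg1|apply: idle_leg2].
- by do !apply: idleM; first [apply: idle_leg1|apply: idle_leg2].
- by do !apply: idleM; first [apply: idle_leg1|apply: idle_leg2].
- by do !apply: idleM; first [apply: idle_leg1|apply: idle_leg2].
rewrite (boundary2_left ab ac ad bc bd cd _ _ R2u Y1 Y2).
rewrite (boundary2_right ac ad bc bd cd _ _ R2u Y3 Y4).
move/(congr1 (@leg2 K n 4 c d)): E.
by rewrite !M4 !(leg2_leg_1 _ cd) !(leg2_leg_2 _ cd) !(leg2_op21 _ cd).
Qed.

End DualReflection.

(** * Commuting transfer matrices *)

Section Sklyanin.

Section Ring.
Variable S : pzRingType.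
Implicit Types (I : eqType).

Lemma comm_prod I (l : seq I) (F : I -> S) u :
  (forall i, i \in l -> u * F i = F i * u) ->
  u * \prod_(i <- l) F i = (\prod_(i <- l) F i) * u.
Proof.
elim: l => [|i l IH] H; first by rewrite big_nil mulr1 mul1r.
rewrite big_cons mulrA H ?mem_head // -!mulrA IH // => j jl.
by apply: H; rewrite inE jl orbT.
Qed.

(** The two products are ordered oppositely, so factors of the same site meet next to [B]; once
    exchanged, they move outward past those of the other sites. *)
Lemma prod_cross I (l : seq I) (r m : I -> S) B : uniq l ->
  (forall i, r i * B * m i = m i * B * r i) ->
  (forall i j, i != j -> r i * m j = m j * r i) ->
  (\prod_(i <- rev l) r i) * B * (\prod_(i <- l) m i) =
  (\prod_(i <- l) m i) * B * (\prod_(i <- rev l) r i).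
Proof.
move=> + rBm rm; elim: l => [_|i l IH /= /andP[il ul]].
  by rewrite !big_nil !mulr1 !mul1r.
have ne j : j \in l -> i != j by move=> jl; apply: contraNneq il => ->.
rewrite rev_cons -cats1 big_cat big_seq1 big_cons /=.
set U := \prod_(j <- rev l) r j in IH *; set M := \prod_(j <- l) m j in IH *.
have iM : r i * M = M * r i.
  by apply: comm_prod => j /ne /rm.
have iU : m i * U = U * m i.
  by apply: comm_prod => j; rewrite mem_rev => /ne; rewrite eq_sym => /rm.
rewrite mulrA (mulr_eq3 (rBm i)) -iU -mulrA iM mulrA.
rewrite -[m i * U * B]mulrA -[m i * (U * B) * M]mulrA.
by rewrite IH // !mulrA.
Qed.

(** Both products run in the same order, hence they interleave into pairs [r_i m_i], and [A] passes
    one pair at a time. *)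
Lemma prod_pass I (l : seq I) (r m : I -> S) A : uniq l ->
  (forall i, A * r i * m i = m i * r i * A) ->
  (forall i j, i != j -> r i * m j = m j * r i) ->
  A * (\prod_(i <- l) r i) * (\prod_(i <- l) m i) =
  (\prod_(i <- l) m i) * (\prod_(i <- l) r i) * A.
Proof.
move=> + Arm rm; elim: l => [_|i l IH /= /andP[il ul]].
  by rewrite !big_nil !mulr1 !mul1r.
have ne j : j \in l -> i != j by move=> jl; apply: contraNneq il => ->.
rewrite !big_cons.
set U := \prod_(j <- l) r j in IH *; set M := \prod_(j <- l) m j in IH *.
have iM : r i * M = M * r i by apply: comm_prod => j /ne /rm.
have iU : m i * U = U * m i.
  by apply: comm_prod => j /ne; rewrite eq_sym => /rm.
rewrite !mulrA (mulr_eq2 (esym iU)) Arm (mulr_eq2 (esym iM)) -!mulrA.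
by congr (_ * (_ * _)); rewrite !mulrA IH.
Qed.

(** [L0 k0 U0] and [M1 k1 V1] are the dressed boundary operators of two auxiliary legs; [A], [A']
    are the factors with argument [x/y], and [B], [B'] those with [xy]. The exchange relations bring
    [k0] and [k1] next to [B], so that [Ak] applies, and then reassemble the dressings. *)
Lemma dressed_reflection (A B B' A' L0 U0 M1 V1 k0 k1 : S) :
  U0 * B * M1 = M1 * B * U0 -> A * L0 * M1 = M1 * L0 * A ->
  V1 * B' * L0 = L0 * B' * V1 -> A' * U0 * V1 = V1 * U0 * A' ->
  k0 * M1 = M1 * k0 -> k0 * V1 = V1 * k0 ->
  k1 * L0 = L0 * k1 -> k1 * U0 = U0 * k1 ->
  A * k0 * B * k1 = k1 * B' * k0 * A' ->
  A * (L0 * k0 * U0) * B * (M1 * k1 * V1) =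
  (M1 * k1 * V1) * B' * (L0 * k0 * U0) * A'.
Proof.
move=> UBM ALM VBL AUV kM kV kL kU Ak.
have Ak' z : z * A * k0 * B * k1 = z * k1 * B' * k0 * A'.
  by rewrite -!mulrA; congr (_ * _); rewrite !mulrA.
rewrite !mulrA (mulr_eq3 UBM) (mulr_eq2 kM) ALM (mulr_eq2 (esym kU)) Ak' (mulr_eq3 AUV).
by rewrite (mulr_eq3 VBL) (mulr_eq2 kL) (mulr_eq2 (esym kV)).
Qed.

End Ring.

Section Traces.
Variables (K : numFieldType) (n k : nat).
Implicit Types (p q : 'I_k) (A X : 'M[K]_(n * n)).

(** Inserting [tilde X] and [X] does not change the trace over [p], and the factors on [q] can enter
    that trace because they are idle on [p]. *)
Lemma Tr_mul_Tr p q X (K0 K1 : 'M[K]_n) C0 C1 : p != q -> ptrans1 X \in unitmx ->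
  idle q C0 -> idle p C1 ->
  Tr p (leg1 p K0 * C0) * Tr q (leg1 q K1 * C1) =
  Tr q (Tr p (leg1 q K1 * leg2 p q (tilde X) * leg1 p K0
              * (C0 * leg2 p q X * C1))).
Proof.
move=> pq Xu f0 f1; have qp : q != p by rewrite eq_sym.
have fK0 : idle q (leg1 p K0) by exact: idle_leg1.
have fK1 : idle p (leg1 q K1) by exact: idle_leg1.
have fKC : idle q (leg1 p K0 * C0) by exact: idleM.
have fT : idle q (Tr p (leg1 p K0 * C0)) by exact: idle_Tr.
rewrite !mulrA (TrMr _ f1) -!mulrA (TrMl _ fK1) !mulrA.
rewrite -[leg2 p q (tilde X) * _ * C0]mulrA (Tr_tilde pq Xu fKC).
by rewrite (idleE _ fT) -(TrMl _ fT) mulrA.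
Qed.

Lemma traces_commute p q A X (K0 K1 : 'M[K]_n) C0 C1 : p != q ->
  A \in unitmx -> ptrans1 X \in unitmx -> idle q C0 -> idle p C1 ->
  A *m leg_2 K1 *m tilde X *m leg_1 K0 =
    leg_1 K0 *m op21 (tilde X) *m leg_2 K1 *m op21 A ->
  leg2 q p A * C0 * leg2 p q X * C1 = C1 * leg2 q p X * C0 * leg2 p q A ->
  let t0 := Tr p (leg1 p K0 * C0) in let t1 := Tr q (leg1 q K1 * C1) in
  t0 * t1 = t1 * t0.
Proof.
move=> pq Au Xu f0 f1 D RE; have qp : q != p by rewrite eq_sym.
rewrite /= (Tr_mul_Tr _ _ pq Xu f0 f1).
have M4 (U V W Y : 'M[K]_(n * n)) : leg2 p q (U *m V *m W *m Y) =
    leg2 p q U * leg2 p q V * leg2 p q W * leg2 p q Y.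
  by rewrite !(leg2M _ _ pq).
move/(congr1 (@leg2 K n k p q)): D.
rewrite !M4 !(leg2_leg_1 _ pq) !(leg2_leg_2 _ pq) !(leg2_op21 _ pq) => D.
have AV : leg2 q p (invmx A) * leg2 q p A = 1.
  by rewrite -(leg2M _ _ qp) mulVmx // leg2_1.
have VA : leg2 q p A * leg2 q p (invmx A) = 1.
  by rewrite -(leg2M _ _ qp) mulmxV // leg2_1.
set s := leg1 q K1 * _ * _; set x := C0 * _ * C1.
(* After inserting [A^-1 A], [RE] exchanges [C0] and [C1] and leaves [A_pq] on the right. The double
   trace carries it to the front, where [D] exchanges [K0] and [K1] and turns it into [A_qp], which
   cancels [A_qp^-1]. *)
have -> : s * x = s * leg2 q p (invmx A) *
    (C1 * leg2 q p X * C0) * leg2 p q A.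
  by rewrite -[RHS]mulrA -RE -!mulrA [leg2 q p (invmx A) * _]mulrA AV mul1r !mulrA.
rewrite (TrC _ qp) -(Tr2_cyc _ _ pq) !mulrA.
rewrite [leg2 p q A * _ * _ * _](_ : _ = leg1 p K0 * leg2 q p (tilde X) *
  leg1 q K1 * leg2 q p A); last by rewrite -D.
rewrite (mulr_eq2 (_ : leg2 q p A * leg2 q p (invmx A) = 1 * 1)) ?mulr1 //.
by rewrite (Tr_mul_Tr _ _ qp Xu f1 f0) !mulrA.
Qed.

End Traces.

End Sklyanin.

(** * The transfer matrix in the presence of auxiliary legs *)

Section Transfer.
Variables (K : numFieldType) (n N : nat).
Variables (K' Km : K -> 'M[K]_n) (R : K -> 'M[K]_(n * n)) (z : 'I_N -> K).

Lemma map_rev_enum_ord : [seq rev_ord i | i <- index_enum 'I_N] = rev (index_enum 'I_N).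
Proof.
rewrite [index_enum _]unlock -enumT.
apply: (inj_map val_inj); rewrite -map_comp map_rev val_enum_ord.
have sz : size [seq (val \o @rev_ord N) i | i <- enum 'I_N] = N.
  by rewrite size_map size_enum_ord.
apply: (@eq_from_nth _ 0%N) => [|i]; first by rewrite sz size_rev size_iota.
rewrite sz => iN; rewrite nth_rev size_iota // nth_iota; last first.
  by rewrite ltn_subrL (leq_ltn_trans _ iN).
rewrite (nth_map (Ordinal iN)) ?size_enum_ord //= add0n.
by rewrite nth_enum_ord.
Qed.

(** The formula inside [reg]. Where a matrix to be inverted is singular, it depends on the default
    value of [invmx], so it is used only off such points. *)
Definition bare_transfer (x : K) : 'M[K]_(tdim n N) :=
  ptrace0
    (leg1 ord0 (K' x)
     *m (\prod_(i < N) invmx (leg2 ord0 (lift ord0 i) (R (x * z i)^-1)))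
     *m leg1 ord0 (Km x)
     *m (\prod_(i < N) leg2 ord0 (lift ord0 (rev_ord i)) (R (x / z (rev_ord i))))).

Lemma transferE : transfer K' R Km z = reg bare_transfer.
Proof. by []. Qed.

Section Legs.
Variables (m : nat) (p : 'I_m) (g : 'I_N -> 'I_m).

Definition monodromyL x : 'M[K]_(tdim n m) :=
  \prod_(i <- index_enum 'I_N) invmx (leg2 p (g i) (R (x * z i)^-1)).
Definition monodromyU x : 'M[K]_(tdim n m) :=
  \prod_(i <- rev (index_enum 'I_N)) leg2 p (g i) (R (x / z i)).
Definition dressed x := monodromyL x * leg1 p (Km x) * monodromyU x.

End Legs.

Lemma leg2_unit k (i j : 'I_k) (X : 'M[K]_(n * n)) : i != j -> X \in unitmx ->
  leg2 i j X \in unitmx.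
Proof.
move=> ij Xu; have E : leg2 i j X *m leg2 i j (invmx X) = 1%:M.
  by rewrite mulmxE -leg2M // mulmxV // leg2_1.
by case: (mulmx1_unit E).
Qed.

Lemma emb_bare_transfer m (f : 'I_N.+1 -> 'I_m) (g : 'I_N -> 'I_m) x :
  injective f -> (forall i, g i = f (lift ord0 i)) ->
  (forall i, R (x * z i)^-1 \in unitmx) ->
  emb g (bare_transfer x) =
  Tr (f ord0) (leg1 (f ord0) (K' x) * dressed (f ord0) g x).
Proof.
move=> f_inj gE Ru; rewrite (emb_ptrace0 _ f_inj gE) !mulmxE !(embM f_inj).
congr (Tr _ _); rewrite !(emb_leg1 f_inj) /dressed !mulrA; congr (_ * _ * _ * _).
  rewrite (big_morph _ (embM f_inj) (emb1 _ _ f)); apply: eq_bigr => i _.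
  by rewrite emb_inv ?leg2_unit // (emb_leg2 f_inj) gE.
rewrite (big_morph _ (embM f_inj) (emb1 _ _ f)) /monodromyU -map_rev_enum_ord.
by rewrite big_map; apply: eq_bigr => i _; rewrite (emb_leg2 f_inj) gE.
Qed.

Lemma idle_prod m (l : 'I_m) (I : Type) (r : seq I) (F : I -> 'M[K]_(tdim n m)) :
  (forall i, idle l (F i)) -> idle l (\prod_(i <- r) F i).
Proof.
move=> H; apply: (big_ind (idle l)) => // [|u v fu fv]; last exact: idleM.
by split=> A; rewrite mulr1 mul1r.
Qed.

Lemma comm_inv m (A B : 'M[K]_m) : A \in unitmx -> A * B = B * A ->
  invmx A * B = B * invmx A.
Proof.
rewrite -!mulmxE => Au AB; rewrite -[B in LHS](mulmxK Au) -AB.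
by rewrite !mulmxA mulVmx // mul1mx.
Qed.

Lemma idle_inv m (l : 'I_m) (A : 'M[K]_(tdim n m)) :
  A \in unitmx -> idle l A -> idle l (invmx A).
Proof.
by move=> Au [fA]; split=> B; rewrite (comm_inv Au).
Qed.


(** The left monodromy consists of inverses, so the Yang-Baxter equation is needed with one factor
    inverted, and in [pass_inv] with two. *)
Lemma cross_inv m (s r B : 'M[K]_m) : s \in unitmx ->
  B * r * s = s * r * B -> r * B * invmx s = invmx s * B * r.
Proof.
rewrite -!mulmxE => su E; rewrite -[LHS](mulKmx su).
by rewrite [s *m (_ *m _)]mulmxA [s *m (_ *m _)]mulmxA -E mulmxK // mulmxA.
Qed.

Lemma pass_inv m (s t A : 'M[K]_m) : s \in unitmx -> t \in unitmx ->
  A * t * s = s * t * A -> A * invmx s * invmx t = invmx t * invmx s * A.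
Proof.
rewrite -!mulmxE => su tu E.
have {1}-> : A = invmx t *m invmx s *m (A *m t *m s).
  by rewrite E !mulmxA mulmxKV // mulVmx // mul1mx.
by rewrite !mulmxA mulmxK // mulmxK.
Qed.

Lemma comm_leg2 m (i j l o : 'I_m) (X Y : 'M[K]_(n * n)) :
  uniq [:: i; j; l; o] -> leg2 i j X * leg2 l o Y = leg2 l o Y * leg2 i j X.
Proof.
rewrite /= !inE !negb_or andbT => /andP[/and3P[ij il io] /andP[/andP[jl jo] lo]].
by apply: idle_comm2 => //; apply: idle_leg2.
Qed.

(* In the proof, the legs 0 and 1 are two copies of the auxiliary space and the
   legs i + 2 are the quantum ones. *)
Lemma bare_transfer_commute (x y : K) : (0 < N)%N -> x != 0 -> y != 0 ->
  (forall i, z i != 0) ->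
  (forall u w, u != 0 -> w != 0 -> yb3 (R (u / w)) (R u) (R w)) ->
  (forall i, R (x * z i)^-1 \in unitmx) ->
  (forall i, R (y * z i)^-1 \in unitmx) ->
  R (x / y) \in unitmx -> ptrans1 (R (x * y)) \in unitmx ->
  reflection_eq (fun x => op21 (R x)) R Km x y ->
  R (x / y) *m leg_2 (K' y) *m tilde (R (x * y)) *m leg_1 (K' x) =
    leg_1 (K' x) *m op21 (tilde (R (x * y))) *m leg_2 (K' y) *m op21 (R (x / y)) ->
  bare_transfer x *m bare_transfer y = bare_transfer y *m bare_transfer x.
Proof.
move=> N0 x0 y0 z0 yb Rx Ry Rxy Rt RE D.
pose p : 'I_N.+2 := ord0; pose q : 'I_N.+2 := lift ord0 ord0.
pose g (i : 'I_N) : 'I_N.+2 := lift ord0 (lift ord0 i).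
have g_inj : injective g by move=> i j /lift_inj /lift_inj.
have pq : p != q by [].
have qp : q != p by [].
have pg i : p != g i by [].
have qg i : q != g i by rewrite -val_eqE.
(* Equality may be tested after adjoining the auxiliary legs [p] and [q]. *)
apply: (emb_inj g_inj N0); rewrite !mulmxE !(embM g_inj).
have Ex : emb g (bare_transfer x) = Tr p (leg1 p (K' x) * dressed p g x).
  (* [lift q] skips [q] and so places the auxiliary leg of the transfer matrix at [x] in [p]; for
     [y], [lift ord0] skips [p]. *)
  have f_inj : injective (lift q : 'I_N.+1 -> 'I_N.+2) := lift_inj.
  have p_eq : p = lift q ord0 by apply: val_inj.
  rewrite {1 2 3}p_eq; apply: emb_bare_transfer => // i.
  by apply: val_inj.
have Ey : emb g (bare_transfer y) = Tr q (leg1 q (K' y) * dressed q g y).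
  by apply: (emb_bare_transfer (f := lift ord0)) => //; exact: lift_inj.
rewrite Ex Ey; clear Ex Ey; clearbody p q g.
have gp i : g i != p by rewrite eq_sym.
have gq i : g i != q by rewrite eq_sym.
have upq i : uniq [:: p; q; g i] by rewrite /= !inE negb_or pq pg qg.
have uqp i : uniq [:: q; p; g i] by rewrite /= !inE negb_or qp pg qg.
have upqgg i j : i != j -> uniq [:: p; g i; q; g j].
  move=> ij; rewrite /= !inE !negb_or pq !pg gq qg /= andbT.
  by apply: contra ij => /eqP/g_inj ->.
have unitL l u : (forall i, l != g i) -> (forall i, R (u * z i)^-1 \in unitmx) ->
    forall i, leg2 l (g i) (R (u * z i)^-1) \in unitmx.
  by move=> lg Ru i; apply: leg2_unit.
have iL l l' u : (forall i, l != g i) -> (forall i, l' != g i) -> l' != l ->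
    (forall i, R (u * z i)^-1 \in unitmx) -> idle l' (monodromyL l g u).
  move=> lg lg' ll' Ru; apply: idle_prod => i; apply: idle_inv; first exact: unitL.
  exact: idle_leg2.
have iU l l' u : (forall i, l != g i) -> (forall i, l' != g i) -> l' != l ->
    idle l' (monodromyU l g u).
  by move=> lg lg' ll'; apply: idle_prod => i; apply: idle_leg2.
have ixL := iL p q x pg qg qp Rx.
have iyL := iL q p y qg pg pq Ry.
have ixU := iU p q x pg qg qp.
have iyU := iU q p y qg pg pq.
apply: (traces_commute pq Rxy Rt) => //.
- by rewrite /dressed; apply: idleM => //; apply: idleM => //; apply: idle_leg1.
- by rewrite /dressed; apply: idleM => //; apply: idleM => //; apply: idle_leg1.
have ybL u w u' i : u != 0 -> w != 0 -> u' = u / w -> yb3 (R u') (R u) (R w).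
  by move=> u0 w0 ->; apply: yb.
have xz0 i : (x * z i)^-1 != 0 by rewrite invr_eq0 mulf_neq0.
have yz0 i : (y * z i)^-1 != 0 by rewrite invr_eq0 mulf_neq0.
have xdz0 i : x / z i != 0 by rewrite mulf_neq0 ?invr_eq0.
have ydz0 i : y / z i != 0 by rewrite mulf_neq0 ?invr_eq0.
have un := index_enum_uniq 'I_N.
(* In each Yang-Baxter instance [z_i] drops out of the quotient [u / w]. It is [xy] for monodromies
   on opposite sides of their [K^-] ([prod_cross]) and [x/y] for monodromies on the same side
   ([prod_pass]). *)
apply: dressed_reflection.
- apply: prod_cross => // [i|i j ij].
    apply: cross_inv; first exact: unitL.
    apply: (yb3_legs _ (upq i)); apply: ybL => //.
    by rewrite invrK mulrACA mulVf // mulr1.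
  apply/esym/comm_inv; first exact: unitL.
  by apply/esym/comm_leg2/upqgg.
- apply: prod_pass => // [i|i j ij].
    apply: pass_inv; [exact: unitL|exact: unitL|].
    apply: (yb3_legs _ (uqp i)); apply: ybL => //.
    by rewrite invrK invfM mulrACA mulVf // mulr1 mulrC.
  apply: comm_inv; first exact: unitL.
  apply/esym/comm_inv; first exact: unitL.
  by apply/esym/comm_leg2/upqgg.
- apply: prod_cross => // [i|i j ij].
    apply: cross_inv; first exact: unitL.
    apply: (yb3_legs _ (uqp i)); apply: ybL => //.
    by rewrite invrK mulrACA mulVf // mulr1 mulrC.
  apply/esym/comm_inv; first exact: unitL.
  by apply/comm_leg2/upqgg; rewrite eq_sym.
- apply: prod_pass => // [|i|i j ij].
  + by rewrite rev_uniq.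
  + apply: (yb3_legs _ (upq i)); apply: ybL => //.
    by rewrite invf_div mulrA divfK.
  + by apply/comm_leg2/upqgg.
- exact: idleE.
- exact: idleE.
- exact: idleE.
- exact: idleE.
have M4 (U V W Y : 'M[K]_(n * n)) : leg2 p q (U *m V *m W *m Y) =
    leg2 p q U * leg2 p q V * leg2 p q W * leg2 p q Y.
  by rewrite !(leg2M _ _ pq).
move/(congr1 (@leg2 K n N.+2 p q)): RE.
by rewrite !M4 !(leg2_leg_1 _ pq) !(leg2_leg_2 _ pq) !(leg2_op21 _ pq).
Qed.

End Transfer.

(** * Polynomial functions and limits *)

Section PolynomialFunctions.
Variable K : numFieldType.
Implicit Types (a c : K) (p : {poly K}).

Lemma cvg_add (T : Type) (Fl : set_system T) {FF : Filter Fl}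
    (f g : T -> K) (u v : K) :
  f @ Fl --> u -> g @ Fl --> v -> (fun x => f x + g x) @ Fl --> u + v.
Proof. exact: cvgD. Qed.

Lemma cvg_mul (T : Type) (Fl : set_system T) {FF : Filter Fl}
    (f g : T -> K) (u v : K) :
  f @ Fl --> u -> g @ Fl --> v -> (fun x => f x * g x) @ Fl --> u * v.
Proof. exact: cvgM. Qed.

Definition pfun (f : K -> K) := exists p, forall x, f x = p.[x].

Lemma pfun_cst c : pfun (fun=> c).
Proof. by exists c%:P => x; rewrite hornerC. Qed.

Lemma pfun_id : pfun id.
Proof. by exists 'X => x; rewrite hornerX. Qed.

Lemma pfunD f g : pfun f -> pfun g -> pfun (fun x => f x + g x).
Proof. by move=> [p fp] [q gq]; exists (p + q) => x; rewrite hornerD fp gq. Qed.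

Lemma pfunM f g : pfun f -> pfun g -> pfun (fun x => f x * g x).
Proof. by move=> [p fp] [q gq]; exists (p * q) => x; rewrite hornerM fp gq. Qed.

Lemma pfun_comp f g : pfun f -> pfun g -> pfun (fun x => f (g x)).
Proof.
by move=> [p fp] [q gq]; exists (p \Po q) => x; rewrite horner_comp fp gq.
Qed.

Lemma pfun_sum (I : Type) (r : seq I) (F : I -> K -> K) :
  (forall i, pfun (F i)) -> pfun (fun x => \sum_(i <- r) F i x).
Proof.
move=> H; elim: r => [|i r [q Hq]].
  by exists 0 => x; rewrite big_nil horner0.
have [p Hp] := H i; exists (p + q) => x.
by rewrite big_cons hornerD Hp Hq.
Qed.

Lemma pfun_prod (I : Type) (r : seq I) (F : I -> K -> K) :
  (forall i, pfun (F i)) -> pfun (fun x => \prod_(i <- r) F i x).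
Proof.
move=> H; elim: r => [|i r [q Hq]].
  by exists 1 => x; rewrite big_nil hornerC.
have [p Hp] := H i; exists (p * q) => x.
by rewrite big_cons hornerM Hp Hq.
Qed.

Lemma pfun_continuous f : pfun f -> continuous f.
Proof.
move=> [p fp]; have -> : f = horner p by apply/funext.
elim/poly_ind: p {f fp} => [|p c IH] x.
  have -> : horner 0 = cst (0 : K) by apply/funext => y; rewrite horner0.
  exact: cst_continuous.
have -> : horner (p * 'X + c%:P) = (fun y => p.[y] * y + c).
  by apply/funext => y; rewrite hornerMXaddC.
exact: (cvg_add (cvg_mul (IH x) (@cvg_id _ _)) (cvg_cst c)).
Qed.

Lemma near_neq a c : a != c -> \forall x \near a, x != c.
Proof.
move=> ac; have H : (fun x : K => x + - c) @ a --> a + - c.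
  have Hi : (fun x : K => x) @ a --> a by move=> A.
  exact: (cvg_add Hi (cvg_cst (- c))).
have ac' : a + - c != 0 by rewrite subr_eq0.
have := @cvgr_neq0 K K K (nbhs a) (nbhs_filter a) _ _ H ac'.
by apply: filterS => x; rewrite subr_eq0.
Qed.

Lemma dnbhs_neq a c : \forall x \near a^', x != c.
Proof.
have [->|ac] := eqVneq a c; first exact: nbhs_dnbhs_neq.
by apply: cvg_within; exact: near_neq.
Qed.

Lemma roots_seq p : p != 0 -> exists s : seq K, forall x, root p x -> x \in s.
Proof.
move: {2}(size p) (leqnn (size p)) => m; elim: m p => [|m IH] p.
  by rewrite leqn0 size_poly_eq0 => ->.
move=> sp p0; case: (pselect (exists x, root p x)) => [[x px]|nr]; last first.
  by exists [::] => x px; case: nr; exists x.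
have [q pE] := factor_theorem _ _ px.
have q0 : q != 0 by apply: contraNneq p0 => q0; rewrite pE q0 mul0r.
have [|s Hs] := IH q _ q0.
  by move: sp; rewrite pE size_Mmonic ?monicXsubC // size_XsubC addn2.
exists (x :: s) => y; rewrite pE rootM root_XsubC inE => /orP[/Hs->|->//].
by rewrite orbT.
Qed.

(** There are finitely many roots, and [f] avoids each near [a]. Asking only this of [f] lets one
    lemma serve the arguments [x^2], [x y], [x / y] and [1 / (x z_i)], even where they have a pole
    at [a]. *)
Lemma near_horner_neq0 p f a : p != 0 ->
  (forall c, \forall x \near a^', f x != c) ->
  \forall x \near a^', p.[f x] != 0.
Proof.
move=> /roots_seq[s Hs] Hf.
suff : \forall x \near a^', f x \notin s.
  by apply: filterS => x; apply: contra => /Hs.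
elim: s {Hs} => [|c s IH]; first exact: nearW.
near=> x; rewrite inE negb_or; apply/andP; split; near: x => //; exact: Hf.
Unshelve. all: by end_near. Qed.

Lemma pfun_near_neq0 p a : p != 0 -> \forall x \near a^', p.[x] != 0.
Proof. by move=> p0; apply: (near_horner_neq0 (f := id)) => // c; exact: dnbhs_neq. Qed.

Lemma near_fibre_mul a c u : c != 0 -> \forall x \near a^', x * c != u.
Proof.
move=> c0; move: (dnbhs_neq a (u / c)); apply: filterS => x.
by apply: contra_neq => <-; rewrite mulfK.
Qed.

Lemma near_fibre_div a c u : c != 0 -> \forall x \near a^', c / x != u.
Proof.
move=> c0; move: (dnbhs_neq a (c / u)); apply: filterS => x.
by apply: contra_neq => <-; rewrite invf_div mulrC divfK.
Qed.

Lemma near_fibre_inv a f : (forall u, \forall x \near a^', f x != u) ->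
  forall u : K, \forall x \near a^', (f x)^-1 != u.
Proof.
move=> H u; move: (H u^-1); apply: filterS => x.
by apply: contra_neq => <-; rewrite invrK.
Qed.

Lemma near_fibre_sqr a u : \forall x \near a^', x ^+ 2 != u.
Proof.
have p0 : 'X^2 - u%:P != 0 by rewrite monic_neq0 ?monicXnsubC.
move: (pfun_near_neq0 a p0); apply: filterS => x.
by rewrite hornerD hornerN hornerC hornerXn subr_eq0.
Qed.

Lemma pfun_near0 f a : pfun f -> (\forall x \near a^', f x = 0) -> forall x, f x = 0.
Proof.
move=> [p fp] f0 x; rewrite fp; have [->|p0] := eqVneq p 0; first by rewrite horner0.
have [y [/eqP]] : exists y, p.[y] != 0 /\ p.[y] = 0.
  apply: (@filter_ex _ a^'); near=> y; split; near: y; first exact: pfun_near_neq0.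
  by move: f0; apply: filterS => y <-.
by [].
Unshelve. all: by end_near. Qed.

(** One variable at a time: for [x'] near [a] the vanishing extends to all [y], and then, for each
    [y], to all [x]. *)
Lemma pfun2_near0 (H : K -> K -> K) a b :
  (forall x, pfun (H x)) -> (forall y, pfun (H ^~ y)) ->
  (\forall x \near a^', \forall y \near b^', H x y = 0) ->
  forall x y, H x y = 0.
Proof.
move=> H1 H2 H0 x y; apply: (pfun_near0 (H2 y) (a := a)).
by move: H0; apply: filterS => x' /(pfun_near0 (H1 x')).
Qed.

End PolynomialFunctions.

(** * Entrywise limits of matrix functions *)

Section EntrywiseLimits.
Variable K : numFieldType.

Lemma cvg_near_trans (T : Type) (Fl : set_system T) {FF : Filter Fl}
    (f g : T -> K) (l : K) : (\forall x \near Fl, f x = g x) -> f @ Fl --> l -> g @ Fl --> l.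
Proof. by move=> fg; apply: cvg_trans; exact: near_eq_cvg. Qed.

(** Products, determinants and adjugates are built from finite sums and products of entries, so in
    this form their limits reduce to limits in [K]. *)
Definition mcvg (T : Type) (Fl : set_system T) m p (F : T -> 'M[K]_(m, p))
    (L : 'M[K]_(m, p)) :=
  forall i j, (fun x => F x i j) @ Fl --> L i j.

Lemma mcvg_cvg (T : Type) (Fl : set_system T) {FF : Filter Fl} m p
    (F : T -> 'M[K]_(m, p)) L : mcvg Fl F L -> F @ Fl --> L.
Proof.
move=> H; apply/cvg_ballP => e e0.
have : \forall x \near Fl, forall i j, ball (L i j) e (F x i j).
  apply: filter_forall => i; apply: filter_forall => j.
  by have /cvg_ballP := H i j; apply.
by apply: filterS => x Hx; split.
Qed.

Lemma cvg_mcvg (T : Type) (Fl : set_system T) {FF : Filter Fl} m p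
    (F : T -> 'M[K]_(m, p)) L : F @ Fl --> L -> mcvg Fl F L.
Proof.
move=> H i j; apply: (@continuous_cvg _ _ _ _ _ _ (fun M : 'M[K]_(m, p) => M i j)) => //.
exact: coord_continuous.
Qed.

Section Filter.
Variables (T : Type) (Fl : set_system T).
Context {FF : Filter Fl}.

Lemma cvg_bigsum (I : Type) (r : seq I) (P : pred I) (f : I -> T -> K) (l : I -> K) :
  (forall i, f i @ Fl --> l i) ->
  (fun x => \sum_(i <- r | P i) f i x) @ Fl --> \sum_(i <- r | P i) l i.
Proof.
move=> H; elim: r => [|i r IH].
  rewrite big_nil; under eq_fun do rewrite big_nil.
  exact: cvg_cst.
rewrite big_cons; under eq_fun do rewrite big_cons.
by case: (P i) => //; exact: (cvg_add (H i) IH).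
Qed.

Lemma cvg_bigprod (I : Type) (r : seq I) (f : I -> T -> K) (l : I -> K) :
  (forall i, f i @ Fl --> l i) ->
  (fun x => \prod_(i <- r) f i x) @ Fl --> \prod_(i <- r) l i.
Proof.
move=> H; elim: r => [|i r IH].
  rewrite big_nil; under eq_fun do rewrite big_nil.
  exact: cvg_cst.
rewrite big_cons; under eq_fun do rewrite big_cons.
exact: (cvg_mul (H i) IH).
Qed.

Lemma cvg_mulb (f : T -> K) l (b : bool) :
  f @ Fl --> l -> (fun x => f x *+ b) @ Fl --> l *+ b.
Proof. by case: b => // _; apply: cvg_cst. Qed.

Lemma mcvg_cst m p (L : 'M[K]_(m, p)) : mcvg Fl (fun=> L) L.
Proof. by move=> i j; apply: cvg_cst. Qed.

Lemma mcvg_mul m p q (F : T -> 'M[K]_(m, p)) (G : T -> 'M[K]_(p, q)) A B :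
  mcvg Fl F A -> mcvg Fl G B -> mcvg Fl (fun x => F x *m G x) (A *m B).
Proof.
move=> HF HG i j; rewrite mxE; under eq_fun do rewrite mxE.
by apply: cvg_bigsum => k; exact: (cvg_mul (HF i k) (HG k j)).
Qed.

Lemma mcvg_prod m (I : Type) (r : seq I) (F : I -> T -> 'M[K]_m) A :
  (forall i, mcvg Fl (F i) (A i)) ->
  mcvg Fl (fun x => \prod_(i <- r) F i x) (\prod_(i <- r) A i).
Proof.
move=> H; elim: r => [|i r IH].
  rewrite big_nil; under eq_fun do rewrite big_nil.
  exact: mcvg_cst.
rewrite big_cons; under eq_fun do rewrite big_cons.
exact: (mcvg_mul (H i) IH).
Qed.

Lemma cvg_det m (F : T -> 'M[K]_m) A :
  mcvg Fl F A -> (fun x => \det (F x)) @ Fl --> \det A.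
Proof.
move=> H; apply: cvg_bigsum => s.
by apply: cvg_mul; [exact: cvg_cst|apply: cvg_bigprod => i; exact: H].
Qed.

Lemma mcvg_adj m (F : T -> 'M[K]_m) A :
  mcvg Fl F A -> mcvg Fl (fun x => \adj (F x)) (\adj A).
Proof.
move=> H i j; rewrite mxE; under eq_fun do rewrite mxE.
apply: cvg_mul; first exact: cvg_cst.
apply: cvg_det => k l; rewrite !mxE; under eq_fun do rewrite !mxE.
exact: H.
Qed.

Lemma mcvg_inv m (F : T -> 'M[K]_m) A : A \in unitmx ->
  mcvg Fl F A -> mcvg Fl (fun x => invmx (F x)) (invmx A).
Proof.
move=> Au H i j; rewrite unitmxE unitfE in Au.
have Hd := cvg_det H.
have -> : invmx A i j = (\det A)^-1 * (\adj A) i j.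
  by rewrite /invmx unitmxE unitfE Au mxE.
have Ha : (fun x => (\adj (F x)) i j) @ Fl --> (\adj A) i j.
  by move: i j; exact: mcvg_adj.
have HV : (fun x => (\det (F x))^-1 * (\adj (F x)) i j) @ Fl -->
    (\det A)^-1 * (\adj A) i j by exact: (cvg_mul (cvgV Au Hd) Ha).
(* [invmx] follows Cramer's formula only where the determinant is nonzero, which holds
   eventually. *)
apply: (cvg_near_trans _ HV).
have := @cvgr_neq0 K K T Fl FF _ _ Hd Au.
by apply: filterS => x du; rewrite /invmx unitmxE unitfE du [RHS]mxE.
Qed.

Variable n : nat.
Implicit Types (X : T -> 'M[K]_(n * n)) (Y : T -> 'M[K]_n).

Lemma mcvg_leg1 k (i : 'I_k) Y A : mcvg Fl Y A ->
  mcvg Fl (fun x => leg1 i (Y x)) (leg1 i A).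
Proof.
move=> H a b; rewrite leg1E; under eq_fun do rewrite leg1E.
by apply: cvg_mulb; exact: H.
Qed.

Lemma mcvg_leg2 k (i j : 'I_k) X A : mcvg Fl X A ->
  mcvg Fl (fun x => leg2 i j (X x)) (leg2 i j A).
Proof.
move=> H a b; rewrite leg2E; under eq_fun do rewrite leg2E.
by apply: cvg_mulb; exact: H.
Qed.

Lemma mcvg_leg_1 Y A : mcvg Fl Y A -> mcvg Fl (fun x => leg_1 (Y x)) (leg_1 A).
Proof.
move=> H a b; rewrite mxE; under eq_fun do rewrite mxE.
by apply: cvg_mul; [exact: H|exact: cvg_cst].
Qed.

Lemma mcvg_ptrans1 X A : mcvg Fl X A ->
  mcvg Fl (fun x => ptrans1 (X x)) (ptrans1 A).
Proof.
move=> H a b; case: (mxtens_indexP a) => p q; case: (mxtens_indexP b) => r s.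
by rewrite ptrans1E; under eq_fun do rewrite ptrans1E; exact: H.
Qed.

Lemma mcvg_ptrace1 X A : mcvg Fl X A ->
  mcvg Fl (fun x => ptrace1 (X x)) (ptrace1 A).
Proof.
move=> H a b; rewrite mxE; under eq_fun do rewrite mxE.
by apply: cvg_bigsum => i; exact: H.
Qed.

Lemma mcvg_ptrace0 k (Z : T -> 'M[K]_(tdim n k.+1)) A : mcvg Fl Z A ->
  mcvg Fl (fun x => ptrace0 (Z x)) (ptrace0 A).
Proof.
move=> H a b; rewrite mxE; under eq_fun do rewrite mxE.
by apply: cvg_bigsum => i; exact: H.
Qed.

End Filter.

Lemma mcvg_unique (T : Type) (Fl : set_system T) {FF : ProperFilter Fl} m p
    (F : T -> 'M[K]_(m, p)) A B : mcvg Fl F A -> mcvg Fl F B -> A = B.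
Proof.
move=> HA HB; apply/matrixP => i j.
exact: (@cvg_unique _ (@norm_hausdorff K K) _ _ _ _ (HA i j) (HB i j)).
Qed.

Lemma mcvg_near (T : Type) (Fl : set_system T) {FF : Filter Fl} m p
    (F G : T -> 'M[K]_(m, p)) A :
  (\forall x \near Fl, F x = G x) -> mcvg Fl F A -> mcvg Fl G A.
Proof.
move=> FG H i j; apply: (cvg_near_trans _ (H i j)).
by move: FG; apply: filterS => x ->.
Qed.

Definition mcont m p (F : K -> 'M[K]_(m, p)) x := mcvg (nbhs x) F (F x).

Lemma mcont_dnbhs m p (F : K -> 'M[K]_(m, p)) x :
  mcont F x -> mcvg x^' F (F x).
Proof.
move=> H i j; apply: cvg_trans (H i j).
by apply: cvg_fmap2; apply: cvg_within.
Qed.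

Lemma reg_cvg m p (F : K -> 'M[K]_(m, p)) x L : mcvg x^' F L -> reg F x = L.
Proof.
move=> H; apply: cvg_lim; first exact: norm_hausdorff.
exact: mcvg_cvg.
Qed.

Lemma near_dnbhs_near (P : K -> Prop) a :
  (\forall x \near a^', P x) -> \forall x \near a^', \forall y \near x, P y.
Proof.
rewrite /dnbhs !near_withinE => /near_join; apply: filterS => x Px xa.
by move: Px (near_neq xa); apply: filterS2 => y Py /Py.
Qed.

Lemma derivable_mcont m p (G : K -> 'M[K]_(m, p)) x : derivable G x 1 -> mcont G x.
Proof.
by move=> /derivable1_diffP/differentiable_continuous H; apply: cvg_mcvg.
Qed.

End EntrywiseLimits.

(** * Matrices with polynomial entries *)

Section PolynomialMatrices.
Variable K : numFieldType.

Definition mpfun m p (F : K -> 'M[K]_(m, p)) :=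
  forall i j, pfun (fun x => F x i j).

Lemma mpfun_cst m p (A : 'M[K]_(m, p)) : mpfun (fun=> A).
Proof. by move=> i j; apply: pfun_cst. Qed.

Lemma mpfunD m p (F G : K -> 'M[K]_(m, p)) :
  mpfun F -> mpfun G -> mpfun (fun x => F x + G x).
Proof.
by move=> HF HG i j; under eq_fun do rewrite mxE; apply: pfunD.
Qed.

Lemma mpfunZ m p f (F : K -> 'M[K]_(m, p)) :
  pfun f -> mpfun F -> mpfun (fun x => f x *: F x).
Proof.
by move=> Hf HF i j; under eq_fun do rewrite mxE; apply: pfunM.
Qed.

Lemma mpfunB m p (F G : K -> 'M[K]_(m, p)) :
  mpfun F -> mpfun G -> mpfun (fun x => F x - G x).
Proof.
move=> HF HG; under eq_fun do rewrite -scaleN1r.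
by apply: mpfunD => //; apply: mpfunZ => //; apply: pfun_cst.
Qed.

Lemma mpfunM m p q (F : K -> 'M[K]_(m, p)) (G : K -> 'M[K]_(p, q)) :
  mpfun F -> mpfun G -> mpfun (fun x => F x *m G x).
Proof.
move=> HF HG i j; under eq_fun do rewrite mxE.
by apply: pfun_sum => k; apply: pfunM.
Qed.

Lemma mpfun_comp m p (F : K -> 'M[K]_(m, p)) f :
  mpfun F -> pfun f -> mpfun (fun x => F (f x)).
Proof. by move=> HF Hf i j; apply: (pfun_comp (HF i j)). Qed.

Lemma mpfun_leg2 n k (i j : 'I_k) (X : K -> 'M[K]_(n * n)) :
  mpfun X -> mpfun (fun x => leg2 i j (X x)).
Proof.
move=> H a b; under eq_fun do rewrite leg2E.
by case: agree; [exact: H|exact: (pfun_cst 0)].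
Qed.

Lemma mpfun_leg_1 n (Y : K -> 'M[K]_n) : mpfun Y -> mpfun (fun x => leg_1 (Y x)).
Proof.
move=> H a b; under eq_fun do rewrite mxE.
by apply: pfunM; [exact: H|exact: pfun_cst].
Qed.

Lemma mpfun_leg_2 n (Y : K -> 'M[K]_n) : mpfun Y -> mpfun (fun x => leg_2 (Y x)).
Proof.
move=> H a b; under eq_fun do rewrite mxE.
by apply: pfunM; [exact: pfun_cst|exact: H].
Qed.

Lemma mpfun_op21 n (X : K -> 'M[K]_(n * n)) : mpfun X -> mpfun (fun x => op21 (X x)).
Proof.
by move=> H; apply: mpfunM; [apply: mpfunM => //|]; apply: mpfun_cst.
Qed.

Lemma mpfun_ptrace1 n (X : K -> 'M[K]_(n * n)) :
  mpfun X -> mpfun (fun x => ptrace1 (X x)).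
Proof.
move=> H a b; under eq_fun do rewrite mxE.
by apply: pfun_sum => i; exact: H.
Qed.

Lemma mpfun_ptrans1 n (X : K -> 'M[K]_(n * n)) :
  mpfun X -> mpfun (fun x => ptrans1 (X x)).
Proof.
move=> H a b; case: (mxtens_indexP a) => p q; case: (mxtens_indexP b) => r s.
under eq_fun do rewrite ptrans1E; exact: H.
Qed.

Lemma pfun_det m (F : K -> 'M[K]_m) : mpfun F -> pfun (fun x => \det (F x)).
Proof.
move=> H; apply: pfun_sum => s; apply: pfunM; first exact: pfun_cst.
by apply: pfun_prod => i; exact: H.
Qed.

Lemma mpfun_mcont m p (F : K -> 'M[K]_(m, p)) x : mpfun F -> mcont F x.
Proof. by move=> H i j; exact: (pfun_continuous (H i j)). Qed.

Lemma mpfun_degree m p d (F : K -> 'M[K]_(m, p)) :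
  polynomial_of_degree d F -> mpfun F.
Proof.
move=> [A [_ FE]] i j.
have -> : (fun x => F x i j) = (fun x => \sum_(k < d.+1) x ^+ k * A k i j).
  by apply/funext => x; rewrite FE summxE; apply: eq_bigr => k _; rewrite mxE.
apply: pfun_sum => k; apply: pfunM; last exact: pfun_cst.
by exists 'X^k => x; rewrite hornerXn.
Qed.

Lemma mpfun2_near0 m p (H : K -> K -> 'M[K]_(m, p)) (a b : K) :
  (forall x, mpfun (H x)) -> (forall y, mpfun (H ^~ y)) ->
  (\forall x \near a^', \forall y \near b^', H x y = 0) ->
  forall x y, H x y = 0.
Proof.
move=> H1 H2 H0 x y; apply/matrixP => i j; rewrite mxE.
apply: (pfun2_near0 (H := fun x y => H x y i j) (a := a) (b := b)).
- by move=> x'; apply: H1.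
- by move=> y'; apply: H2.
move: H0; apply: filterS => x'; apply: filterS => y' ->.
by rewrite mxE.
Qed.

(** The determinant is a polynomial, nonzero because of its value at [c], so [f] has only finitely
    many values to avoid. *)
Lemma near_unitmx m (F : K -> 'M[K]_m) (c a : K) f : mpfun F -> F c \in unitmx ->
  (forall u, \forall x \near a^', f x != u) ->
  \forall x \near a^', F (f x) \in unitmx.
Proof.
move=> /pfun_det[p dE] Fc Hf; have p0 : p != 0.
  by move: Fc; rewrite unitmxE unitfE dE; apply: contraNneq => ->; rewrite horner0.
have := near_horner_neq0 p0 Hf.
by apply: filterS => x; rewrite unitmxE unitfE dE.
Qed.

End PolynomialMatrices.

(** * Genericity and isolated singularities *)

Section Genericity.
Variable K : numFieldType.

(** At a point of [D] outside [A], one of the local equations of [A] has a nonzero value, and by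
    continuity it stays nonzero nearby. *)
Lemma generic_near (V : normedModType K) (D : set V) (P : V -> Prop) :
  open D -> generic D P -> exists q, D q /\ \forall q' \near q, P q'.
Proof.
move=> oD [A [[AD anA] nA PA]].
have [q [Dq nAq]] : exists q, D q /\ ~ A q.
  apply: contrapT => H; apply: nA; apply/seteqP; split => // q Dq.
  by apply: contrapT => Aq; apply: H; exists q.
exists q; split => //; have [k [f [df Af]]] := anA q Dq.
have [i fi] : exists i, f i q != 0.
  apply: contrapT => H; apply: nAq; apply/(nbhs_singleton Af) => i.
  by apply: contrapT => /eqP fi; apply: H; exists i.
have cfi : {for q, continuous (f i)}.
  exact/differentiable_continuous/(nbhs_singleton (df i)).
have fn : \forall q' \near q, f i q' != 0.
  exact: (@cvgr_neq0 K K V (nbhs q) (nbhs_filter q) _ _ cfi fi).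
have Dn : \forall q' \near q, D q' by apply: open_nbhs_nbhs.
near=> q'; apply: PA; first by near: q'.
have AfI : A q' <-> forall i, f i q' = 0 by near: q'.
move/AfI => /(_ i) /eqP; apply/negP.
by near: q'.
Unshelve. all: by end_near. Qed.

Lemma generic1_near (D : set K) (P : K -> Prop) :
  open D -> generic1 D P -> exists a, \forall x \near a^', P x.
Proof.
move=> oD /(generic_near oD)[a [_ H]]; exists a.
exact: cvg_within.
Qed.

Lemma generic2_near (P : K -> K -> Prop) : generic2 nz2 P ->
  exists a b, \forall x \near a^', \forall y \near b^', P x y.
Proof.
have oD : open (@nz2 K).
  rewrite openE => -[a b] [/= a0 b0].
  exists ([set x | x != 0], [set x | x != 0]); last by move=> -[x y] [].
  by split => /=; exact: near_neq.
move=> /(generic_near oD)[[a b] [_ [[A B] [/= nA nB] AB]]].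
exists a, b; apply: cvg_within; move: nA; apply: filterS => x Ax.
apply: cvg_within; move: nB; apply: filterS => y By.
exact: (AB (x, y)).
Qed.

(** Close to [a], but off it, [F] is [(x - a)^-k] times a holomorphic function. *)
Lemma dom_mcont m p (F : K -> 'M[K]_(m, p)) (a : K) : meromorphic_on setT F ->
  \forall x \near a^', mcont F x.
Proof.
move=> /(_ a I)[k [G hG FG]].
have xa := nbhs_dnbhs_neq a.
have FG' := near_dnbhs_near FG.
have hG' : \forall x \near a^', derivable G x 1 by apply: cvg_within.
near=> x.
have FGx : \forall y \near x, F y = (y - a) ^- k *: G y by near: x.
have xa' : x != a by near: x.
have Gx : mcont G x by apply: derivable_mcont; near: x.
have FEx := nbhs_singleton FGx.
rewrite /mcont; apply: (@mcvg_near _ _ _ _ _ _ (fun y => (y - a) ^- k *: G y)).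
  by move: FGx; apply: filterS.
rewrite FEx => i j; rewrite mxE; under eq_fun do rewrite mxE.
have xk0 : (x - a) ^+ k != 0 by rewrite expf_neq0 // subr_eq0.
have pk : pfun (fun y : K => (y - a) ^+ k).
  by exists (('X - a%:P) ^+ k) => y; rewrite horner_exp hornerXsubC.
apply: cvg_mul; last exact: Gx.
exact: (cvgV xk0 (@pfun_continuous K _ pk x)).
Unshelve. all: by end_near. Qed.

End Genericity.

(** * Inversion of the boundary map [phi] *)

Section Boundary.
Variables (K : numFieldType) (n : nat).

Lemma boundary_tens (Y A B : 'M[K]_n) :
  ptrace1 (leg_1 Y *m flip *m (A *t B)) = A *m Y *m B.
Proof.
rewrite -mulmxA flip_tens mulmxA /leg_1 tensmx_mul mul1mx.
apply/matrixP => i j; rewrite mxE [RHS]mxE.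
under eq_bigr do rewrite mul_flipE tensmxE mulrC.
rewrite (eq_bigr (fun k => \sum_l A i k * Y k l * B l j)).
  rewrite exchange_big /=; apply: eq_bigr => l _.
  by rewrite mxE mulr_suml.
by move=> k _; rewrite mxE mulr_sumr; apply: eq_bigr => l _; rewrite mulrA.
Qed.

(** For [T = A *t B] and [X = C *t D] both sides are [C A Y B D], by [boundary_tens]. *)
Lemma boundary_xmul (Y : 'M[K]_n) (X T : 'M[K]_(n * n)) :
  ptrace1 (leg_1 (ptrace1 (leg_1 Y *m flip *m T)) *m flip *m X) =
  ptrace1 (leg_1 Y *m flip *m xmul T X).
Proof.
pose b (Y : 'M[K]_n) (X : 'M[K]_(n * n)) := ptrace1 (leg_1 Y *m flip *m X).
have bDr Z U U' : b Z (U + U') = b Z U + b Z U' by rewrite /b mulmxDr linearD.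
have bZr Z c U : b Z (c *: U) = c *: b Z U by rewrite /b -scalemxAr linearZ.
have bDl Z Z' U : b (Z + Z') U = b Z U + b Z' U.
  rewrite /b -linearD -!mulmxDl; congr (ptrace1 (_ *m _ *m _)).
  by apply/matrixP => i j; rewrite !mxE mulrDl.
have bZl c Z U : b (c *: Z) U = c *: b Z U.
  rewrite /b -linearZ /= !scalemxAl; congr (ptrace1 (_ *m _ *m _)).
  by apply/matrixP => i j; rewrite !mxE mulrA.
rewrite -!/(b _ _).
move: T X; apply: tens_bilin_span => [A B C D|T T' X|c T X|T T' X|c T X].
- by rewrite xmul_tens /b !boundary_tens !mulmxA.
- by rewrite xmulDl !bDr bDl => -> ->.
- by rewrite xmulZl !bZr bZl => ->.
- by rewrite xmulDr !bDr => -> ->.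
- by rewrite xmulZr !bZr => ->.
Qed.

Lemma boundary_tildeK (Y : 'M[K]_n) (X : 'M[K]_(n * n)) : ptrans1 X \in unitmx ->
  ptrace1 (leg_1 (ptrace1 (leg_1 Y *m flip *m tilde X)) *m flip *m X) = Y.
Proof.
move=> Xu; rewrite boundary_xmul xmul_tildel // -tens11 boundary_tens.
by rewrite mul1mx mulmx1.
Qed.

Lemma phi_tilde_inv (R : K -> 'M[K]_(n * n)) (Kp : K -> 'M[K]_n) c a :
  meromorphic_on setT Kp -> mpfun R -> ptrans1 (R c) \in unitmx ->
  \forall x \near a^',
    Kp x = ptrace1 (leg_1 (phi (Rtilde R) Kp x) *m flip *m R (x ^+ 2)).
Proof.
move=> hKp hR Rc.
have sqr_fibre := near_fibre_sqr a.
have Ru := near_unitmx (mpfun_ptrans1 hR) Rc sqr_fibre.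
have Kc := dom_mcont a hKp.
near=> x.
have Rx : ptrans1 (R (x ^+ 2)) \in unitmx by near: x.
have Kx : mcont Kp x by near: x.
have psqr : pfun (fun x : K => x ^+ 2) by exists 'X^2 => y; rewrite hornerXn.
(* [phi] is a limit because of [reg]; the formula is continuous at [x], so the limit is its
   value. *)
have -> : phi (Rtilde R) Kp x =
    ptrace1 (leg_1 (Kp x) *m flip *m tilde (R (x ^+ 2))).
  apply: reg_cvg; apply: (@mcont_dnbhs K n n
    (fun x => ptrace1 (leg_1 (Kp x) *m flip *m tilde (R (x ^+ 2))))).
  apply: mcvg_ptrace1; apply: mcvg_mul.
    by apply: mcvg_mul; [exact: mcvg_leg_1|exact: mcvg_cst].
  apply: mcvg_ptrans1; apply: mcvg_inv => //.
  apply: mcvg_ptrans1.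
  have hR2 : mpfun (fun y => R (y ^+ 2)) by apply: mpfun_comp.
  by move=> i j; exact: (pfun_continuous (hR2 i j)).
by rewrite boundary_tildeK.
Unshelve. all: by end_near. Qed.

End Boundary.

(** * Proof of the theorem *)

Section Commutation.
Variables (K : numFieldType) (n N : nat).
Variables (R : K -> 'M[K]_(n * n)) (Kp Km K' : K -> 'M[K]_n) (z : 'I_N -> K).
Hypotheses (N0 : (0 < N)%N) (z0 : forall i, z i != 0).
Hypotheses (polR : polynomial_of_degree 1 R) (polK' : polynomial_of_degree 2 K').
Hypothesis polKm : polynomial_of_degree 2 Km.
Hypotheses (hR : MerU R) (hRt : MerU (fun x => ptrans1 (R x))).
Hypotheses (hKp : Mer Kp) (K'E : K' = phi (Rtilde R) Kp).
Hypothesis ybe : generic2 nz2 (yang_baxter R).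
Hypothesis rep : generic2 nz2 (reflection_eq R (fun x => op21 (R x)) Kp).
Hypothesis rem : generic2 nz2 (reflection_eq (fun x => op21 (R x)) R Km).

Let pR : mpfun R. Proof. exact: mpfun_degree polR. Qed.
Let pK' : mpfun K'. Proof. exact: mpfun_degree polK'. Qed.
Let pKm : mpfun Km. Proof. exact: mpfun_degree polKm. Qed.

(** With [R x = A_0 + x A_1], take [y A_0 + x A_1]: degree 1 is what lets a single factor [y] clear
    the denominator. *)
Lemma homogenization : exists Rh : K -> K -> 'M[K]_(n * n),
  [/\ forall x, mpfun (Rh x), forall y, mpfun (Rh ^~ y)
    & forall x y, y != 0 -> Rh x y = y *: R (x / y)].
Proof.
have [A [_ RE]] := polR; exists (fun x y => y *: A ord0 + x *: A ord_max).
split=> [x|y|x y y0].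
- apply: mpfunD; apply: mpfunZ; [exact: pfun_id|exact: mpfun_cst|exact: pfun_cst|].
  exact: mpfun_cst.
- apply: mpfunD; apply: mpfunZ; [exact: pfun_cst|exact: mpfun_cst|exact: pfun_id|].
  exact: mpfun_cst.
rewrite RE !big_ord_recl big_ord0 addr0 /= expr0 expr1 scale1r scalerDr scalerA.
rewrite mulrC divfK //; congr (_ + _ *: A _); exact: val_inj.
Qed.

Lemma somewhere_unit m (F : K -> 'M[K]_m) : MerU F -> exists c, F c \in unitmx.
Proof.
move=> [_ /(generic1_near openT)[a H]].
by have [c Hc] := @filter_ex _ a^' _ _ H; exists c.
Qed.

Lemma yang_baxter_all u w : u != 0 -> w != 0 -> yb3 (R (u / w)) (R u) (R w).
Proof.
move=> u0 w0; have [Rh [Rhx Rhy RhE]] := homogenization.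
have [a [b Hab]] := generic2_near ybe.
pose l i j X : 'M[K]_(tdim n 3) := leg2 (inord i : 'I_3) (inord j) X.
(* For [y != 0] this is [y] times the defect of the equation; it is polynomial in each variable, and
   [w != 0] permits dividing at the end. *)
pose H x y := l 0%N 1%N (Rh x y) *m l 0%N 2%N (R x) *m l 1%N 2%N (R y)
  - l 1%N 2%N (R y) *m l 0%N 2%N (R x) *m l 0%N 1%N (Rh x y).
have HE x y : y != 0 -> H x y = y *: (
    l 0%N 1%N (R (x / y)) *m l 0%N 2%N (R x) *m l 1%N 2%N (R y)
    - l 1%N 2%N (R y) *m l 0%N 2%N (R x) *m l 0%N 1%N (R (x / y))).
  move=> y0; rewrite /H /l (RhE _ _ y0) linearZ /= -!scalemxAl -scalemxAr.
  by rewrite scalerBr.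
have H0 : H u w = 0.
  apply: (mpfun2_near0 (a := a) (b := b)).
  - move=> x; apply: mpfunB; do !apply: mpfunM; try exact: mpfun_cst;
      by apply: mpfun_leg2.
  - move=> y; apply: mpfunB; do !apply: mpfunM; try exact: mpfun_cst;
      by apply: mpfun_leg2.
  move: Hab; apply: filterS => x; apply: filterS2 (dnbhs_neq b 0) => y y0 E.
  by rewrite HE // E subrr scaler0.
move/eqP: H0; rewrite HE // scaler_eq0 (negbTE w0) subr_eq0 => /eqP.
exact.
Qed.

(** Serves both reflection equations: [S], [S'] are [R], [R_21] for [K+] and the reverse for [K^-],
    and [Sh], [S'h] are their homogenizations. *)
Lemma reflection_all (S S' : K -> 'M[K]_(n * n)) (Sh S'h : K -> K -> 'M[K]_(n * n))
    (k : K -> 'M[K]_n) a b :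
  mpfun S -> mpfun S' -> mpfun k ->
  (forall x, mpfun (Sh x)) -> (forall y, mpfun (Sh ^~ y)) ->
  (forall x y, y != 0 -> Sh x y = y *: S (x / y)) ->
  (forall x, mpfun (S'h x)) -> (forall y, mpfun (S'h ^~ y)) ->
  (forall x y, y != 0 -> S'h x y = y *: S' (x / y)) ->
  (\forall x \near a^', \forall y \near b^', reflection_eq S S' k x y) ->
  forall x y, y != 0 -> reflection_eq S S' k x y.
Proof.
move=> pS pS' pk Shx Shy ShE S'hx S'hy S'hE Hab u w w0.
have pmull x : pfun ( *%R x) by apply: pfunM; [exact: pfun_cst|exact: pfun_id].
have pmulr y : pfun ( *%R^~ y) by apply: pfunM; [exact: pfun_id|exact: pfun_cst].
pose H x y := Sh x y *m leg_1 (k x) *m S' (x * y) *m leg_2 (k y)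
  - leg_2 (k y) *m S (x * y) *m leg_1 (k x) *m S'h x y.
have HE x y : y != 0 -> H x y = y *: (
    S (x / y) *m leg_1 (k x) *m S' (x * y) *m leg_2 (k y)
    - leg_2 (k y) *m S (x * y) *m leg_1 (k x) *m S' (x / y)).
  by move=> y0; rewrite /H ShE // S'hE // -!scalemxAl -scalemxAr scalerBr.
have H0 : H u w = 0.
  apply: (mpfun2_near0 (a := a) (b := b)).
  - move=> x; apply: mpfunB; do !apply: mpfunM; try exact: mpfun_cst;
      try exact: mpfun_leg_2; try exact: Shx; try exact: S'hx.
    + by apply: mpfun_comp => //; exact: pmull.
    + by apply: mpfun_comp => //; exact: pmull.
  - move=> y; apply: mpfunB; do !apply: mpfunM; try exact: mpfun_cst;
      try exact: mpfun_leg_1; try exact: Shy; try exact: S'hy.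
    + by apply: mpfun_comp => //; exact: pmulr.
    + by apply: mpfun_comp => //; exact: pmulr.
  move: Hab; apply: filterS => x; apply: filterS2 (dnbhs_neq b 0) => y y0 E.
  by rewrite HE // E subrr scaler0.
move/eqP: H0; rewrite HE // scaler_eq0 (negbTE w0) subr_eq0 => /eqP.
exact.
Qed.

Lemma reflection_minus x y : y != 0 -> reflection_eq (fun x => op21 (R x)) R Km x y.
Proof.
have [Rh [Rhx Rhy RhE]] := homogenization; have [a [b Hab]] := generic2_near rem.
apply: (@reflection_all _ _ (fun x y => op21 (Rh x y)) Rh _ a b) => //.
- exact: mpfun_op21.
- by move=> x'; apply: mpfun_op21.
- by move=> y'; apply: (mpfun_op21 (Rhy y')).
- by move=> x' y' y0; rewrite RhE // op21Z.
Qed.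

Let Kpp x := ptrace1 (leg_1 (K' x) *m flip *m R (x ^+ 2)).

Lemma reflection_plus x y : y != 0 -> reflection_eq R (fun x => op21 (R x)) Kpp x y.
Proof.
have [Rh [Rhx Rhy RhE]] := homogenization; have [a [b Hab]] := generic2_near rep.
have [c Rc] := somewhere_unit hRt.
have KppE d : \forall x \near d^', Kp x = Kpp x.
  by rewrite /Kpp K'E; apply: (phi_tilde_inv d _ pR Rc); have [] := hKp.
have psqr : pfun (fun x : K => x ^+ 2) by exists 'X^2 => u; rewrite hornerXn.
have pKpp : mpfun Kpp.
  apply: mpfun_ptrace1; apply: mpfunM; last by apply: mpfun_comp.
  by apply: mpfunM; [exact: mpfun_leg_1|exact: mpfun_cst].
apply: (@reflection_all _ _ Rh (fun x y => op21 (Rh x y)) _ a b) => //.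
- exact: mpfun_op21.
- by move=> x'; apply: mpfun_op21.
- by move=> y'; apply: (mpfun_op21 (Rhy y')).
- by move=> x' y' y0; rewrite RhE // op21Z.
move: (KppE a) Hab; apply: filterS2 => x' Ex; move: (KppE b); apply: filterS2 => y' Ey.
by rewrite /reflection_eq Ex Ey.
Qed.

Lemma dual_reflection_K' x y : x != 0 -> y != 0 ->
  ptrans1 (R (x * y)) \in unitmx ->
  ptrans1 (R (x ^+ 2)) \in unitmx -> ptrans1 (R (y ^+ 2)) \in unitmx ->
  R (x / y) *m leg_2 (K' y) *m tilde (R (x * y)) *m leg_1 (K' x) =
  leg_1 (K' x) *m op21 (tilde (R (x * y))) *m leg_2 (K' y) *m op21 (R (x / y)).
Proof.
move=> x0 y0 uxy ux uy.
have yb s u w : u != 0 -> w != 0 -> s = u / w -> yb3 (R s) (R u) (R w).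
  by move=> u0 w0 ->; apply: yang_baxter_all.
apply: (dual_reflection uxy ux uy).
(* The pairs [(u, w)] are [(x^2, xy)], [(xy, y^2)], [(xy, x/y)] and [(x^2, x/y)]. *)
- by apply: yb; rewrite ?mulf_neq0 //; field; rewrite x0 y0.
- by apply: yb; rewrite ?mulf_neq0 //; field; rewrite y0.
- by apply: yb; rewrite ?mulf_neq0 ?invr_eq0 //; field; rewrite x0 y0.
- by apply: yb; rewrite ?mulf_neq0 ?invr_eq0 //; field; rewrite x0 y0.
exact: (reflection_plus x y0).
Qed.

Let B := bare_transfer K' Km R z.

Lemma near_admissible (a : K) : \forall x \near a^',
  x != 0 /\ forall i, R (x * z i)^-1 \in unitmx.
Proof.
have [c Rc] := somewhere_unit hR.
have H : \forall x \near a^', forall i, R (x * z i)^-1 \in unitmx.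
  apply: filter_forall => i; apply: (near_unitmx pR Rc).
  by apply: near_fibre_inv => u; apply: near_fibre_mul.
by move: (dnbhs_neq a 0) H; apply: filterS2.
Qed.

Lemma mcont_bare_transfer x : x != 0 -> (forall i, R (x * z i)^-1 \in unitmx) ->
  mcont B x.
Proof.
move=> x0 Ru; rewrite /mcont /B /bare_transfer.
have pmul c : pfun (fun x : K => x * c).
  by apply: pfunM; [exact: pfun_id|exact: pfun_cst].
apply: mcvg_ptrace0; apply: mcvg_mul; first apply: mcvg_mul; first apply: mcvg_mul.
- by apply: mcvg_leg1; exact: mpfun_mcont.
- apply: mcvg_prod => i; apply: mcvg_inv; first exact: leg2_unit.
  apply: mcvg_leg2 => j l.
  have xz0 : x * z i != 0 by rewrite mulf_neq0.
  have Rc := pfun_continuous (pR j l).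
  apply: (@continuous_cvg _ _ _ _ _ _ (fun u => R u j l)); first exact: Rc.
  exact: (cvgV xz0 (@pfun_continuous K _ (pmul (z i)) x)).
- by apply: mcvg_leg1; exact: mpfun_mcont.
- apply: mcvg_prod => i; apply: mcvg_leg2.
  have pRz : mpfun (fun x => R (x / z (rev_ord i))) by apply: mpfun_comp.
  by move=> j l; exact: (pfun_continuous (pRz j l)).
Qed.

(** The exceptional values of [y] depend on [x], through [R (x / y)] and [R (x * y)]; hence the
    nested quantifiers. *)
Lemma bare_transfer_comm (a b : K) : \forall x \near a^', \forall y \near b^',
  B x *m B y = B y *m B x.
Proof.
have [c Rc] := somewhere_unit hR; have [d Rd] := somewhere_unit hRt.
have pRt := mpfun_ptrans1 pR.
have uxx := near_unitmx pRt Rd (near_fibre_sqr a).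
have uyy := near_unitmx pRt Rd (near_fibre_sqr b).
have adx := near_admissible a; have ady := near_admissible b.
near=> x.
have [x0 Rx] : x != 0 /\ forall i, R (x * z i)^-1 \in unitmx by near: x.
have ux : ptrans1 (R (x ^+ 2)) \in unitmx by near: x.
have fxy u : \forall y \near b^', x * y != u.
  by under eq_near do rewrite mulrC; apply: near_fibre_mul.
have uxy := near_unitmx pRt Rd fxy.
have udiv := near_unitmx pR Rc (fun u => near_fibre_div b u x0).
near=> y.
have [y0 Ry] : y != 0 /\ forall i, R (y * z i)^-1 \in unitmx by near: y.
have uxy' : ptrans1 (R (x * y)) \in unitmx by near: y.
have uy : ptrans1 (R (y ^+ 2)) \in unitmx by near: y.
have udiv' : R (x / y) \in unitmx by near: y.
apply: bare_transfer_commute => //.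
- exact: yang_baxter_all.
- exact: reflection_minus.
- exact: dual_reflection_K'.
Unshelve. all: by end_near. Qed.

(** Membership in [dom] gives a holomorphic [G] that agrees with [reg B] near [x]. Close to [x], but
    off it, [B] is continuous and so equals [reg B]; hence [B] tends to [G x], which is then
    [reg B x]. *)
Lemma dom_transfer_cvg x : dom (reg B) x -> mcvg x^' B (reg B x).
Proof.
move=> [G hG BG].
have regE : \forall y \near x^', reg B y = B y.
  have := near_admissible x; apply: filterS => y [y0 Ry].
  by apply: reg_cvg; apply: mcont_dnbhs; apply: mcont_bare_transfer.
have BGx : mcvg x^' B (G x).
  apply: (@mcvg_near _ _ _ _ _ _ G); last first.
    by apply: mcont_dnbhs; apply: derivable_mcont; exact: nbhs_singleton hG.
  move: regE BG; apply: filterS2 => y -> ->.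
  by rewrite expr0 invr1 scale1r.
by rewrite (reg_cvg BGx).
Qed.

Lemma transfer_comm x y :
  let T := transfer K' R Km z in
  dom T x -> dom T y -> comm_mx (T x) (T y).
Proof.
rewrite /= transferE -/B => /dom_transfer_cvg Bx /dom_transfer_cvg By.
(* The limit in the second variable is taken first, for fixed [u], following the order of
   quantifiers in [bare_transfer_comm]. *)
have H : \forall u \near x^', B u *m reg B y = reg B y *m B u.
  have := bare_transfer_comm x y; apply: filterS => u Hu.
  apply: (mcvg_unique (Fl := y^') (F := fun w => B u *m B w)).
    by apply: mcvg_mul => //; apply: mcvg_cst.
  apply: (@mcvg_near _ _ _ _ _ _ (fun w => B w *m B u)).
    by move: Hu; apply: filterS => w ->.
  by apply: mcvg_mul => //; apply: mcvg_cst.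
apply: (mcvg_unique (Fl := x^') (F := fun u => B u *m reg B y)).
  by apply: mcvg_mul => //; apply: mcvg_cst.
apply: (@mcvg_near _ _ _ _ _ _ (fun u => reg B y *m B u)).
  by move: H; apply: filterS => u ->.
by apply: mcvg_mul => //; apply: mcvg_cst.
Qed.

End Commutation.

Theorem theorem4p3 (RR : realType) (n N : nat) (hN : (1 <= N)%N)
  (R : RR[i] -> 'M[RR[i]]_(n * n)) (Kp Km : RR[i] -> 'M[RR[i]]_n)
  (M : 'M[RR[i]]_n) (r : RR[i]) (z : 'I_N -> RR[i])
  (hR : MerU R) (hRt : MerU (fun x => ptrans1 (R x)))
  (hKp : MerU Kp) (hKm : MerU Km)
  (hM : M \in unitmx) (hr : r != 0) (hz : forall i, z i != 0)
  (ybe : generic2 nz2 (yang_baxter R))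
  (rep : generic2 nz2 (reflection_eq R (fun x => op21 (R x)) Kp))
  (rem : generic2 nz2 (reflection_eq (fun x => op21 (R x)) R Km))
  (crossing : mer_propto setT
     (fun x => invmx (leg_2 M) *m invmx (R (r ^+ 2 * x)) *m leg_2 M)
     (Rtilde R))
  (commM : generic1 setT (fun x => comm_mx (R x) (M *t M)))
  (bregp : forall e : RR[i], e = 1 \/ e = -1 ->
     dom Kp e /\ propto (Kp e) 1%:M)
  (bregm : forall e : RR[i], e = 1 \/ e = -1 ->
     dom Km e /\ propto (Km e) 1%:M)
  (regR : dom R 1 /\ propto (R 1) flip)
  (J : 'M[RR[i]]_n) (hJ : J \in unitmx)
  (hRJ : generic1 setT (fun x =>
     R x *m (leg_1 J *m leg_2 J) = leg_1 J *m leg_2 J *m op21 (R x)))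
  (bunitp : mer_propto nz (fun x => Kp x *m Kp x^-1) (fun=> 1%:M))
  (bunitm : mer_propto nz (fun x => Km x *m Km x^-1) (fun=> 1%:M))
  (domKm : dom Km r^-1 /\ dom Km (- r^-1))
  (K' : RR[i] -> 'M[RR[i]]_n) (hK' : K' = phi (Rtilde R) Kp)
  (domK' : dom K' 1 /\ dom K' (-1))
  (K'r : forall e : RR[i], e = r^-1 \/ e = - r^-1 ->
     dom K' e /\ propto (K' e) M)
  (polR : polynomial_of_degree 1 R)
  (polK' : polynomial_of_degree 2 K')
  (polKm : polynomial_of_degree 2 Km)
  (v : n.-tuple 'cV[RR[i]]_n) (hv : basis_of fullv v)
  (Rice : forall a b x,
     R x *m (tnth v a *t tnth v b) \in
       (<[tnth v a *t tnth v b]> + <[tnth v b *t tnth v a]>)%VS)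
  (Rtri : forall a b : 'I_n,
     R 0 *m (tnth v a *t tnth v b) \in
       (\sum_(c < n | (c <= a)%N) \sum_(d < n | (b <= d)%N)
          <[tnth v c *t tnth v d]>)%VS)
  (Kmx : forall a x,
     Km x *m tnth v a \in (<[tnth v a]> + <[tnth v (rev_ord a)]>)%VS)
  (K'x : forall a x,
     K' x *m tnth v a \in (<[tnth v a]> + <[tnth v (rev_ord a)]>)%VS)
  (Kmtri : forall a : 'I_n,
     Km 0 *m tnth v a \in
       (\sum_(c < n | (c <= a)%N) <[tnth v (rev_ord c)]>)%VS)
  (K'tri : forall a : 'I_n,
     K' 0 *m tnth v (rev_ord a) \in
       (\sum_(c < n | (c <= a)%N) <[tnth v c]>)%VS) :
  let T := transfer K' R Km z in
  forall x y, dom T x -> dom T y -> comm_mx (T x) (T y).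
Proof.
exact: (transfer_comm hN hz polR polK' polKm hR hRt (proj1 hKp) hK' ybe rep rem).
Qed.
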